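(* Let $H$ be a Hilbert space, $\gamma$ a unitary operator on $H$, and $A=(A(t))_{t\in[0,1]}$ a gap-continuous family of (possibly unbounded) self-adjoint Fredholm operators on $H$, each commuting with $\gamma$. For any flow partition $0=t_0<\dots<t_n=1$, $a_1,\dots,a_n$ of $A$, the $\gamma$-spectral flow computed with this flow partition, $$\mathrm{sf}_\gamma(A)=\sum_{k=1}^n\Big(\mathrm{tr}\big(\gamma|_{E_{[0,a_k]}(A(t_k))}\big)-\mathrm{tr}\big(\gamma|_{E_{[0,a_k]}(A(t_{k-1}))}\big)\Big),$$ satisfies $$\mathrm{sf}_\gamma(A)=\sum_{\lambda\in\mathrm{Eig}(\gamma)}\lambda\,\mathrm{sf}\big(A|_{E_\lambda(\gamma)}\big).$$ In particular, $\mathrm{sf}_\gamma(A)$ is well defined, i.e. independent of the choice of flow partition.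
   Context: For a normal operator $S$ and a Borel set $I$, $P_I(S)$ is the spectral projection and $E_I(S)$ its range; $E_\lambda(S)=E_{\{\lambda\}}(S)$; $\mathrm{Eig}(S)$ is the set of eigenvalues. Gap continuity of $A$ means that $(A(t)+i)^{-1}$ is norm continuous in $t$. $A|_{E_\lambda(\gamma)}$ is the family of restrictions of the $A(t)$ to the invariant subspace $E_\lambda(\gamma)$. A flow partition for $A$ consists of $0=t_0<t_1<\dots<t_n=1$ and numbers $a_1,\dots,a_n\ge0$ such that for each $k$ the projection $P_{[-a_k,a_k]}(A(t))$ has finite rank and is (norm) continuous in $t$ for $t\in[t_{k-1},t_k]$; flow partitions exist. The ordinary spectral flow is $\mathrm{sf}(A)=\sum_{k=1}^n\big(\dim E_{[0,a_k]}(A(t_k))-\dim E_{[0,a_k]}(A(t_{k-1}))\big)$, which is known to be independent of the flow partition. (The sum over $\lambda$ has only finitely many nonzero terms.) *)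

(* Defs.v *)
From HB Require Import structures.
From mathcomp Require Import all_boot all_order all_algebra.
From mathcomp Require Import complex.
From mathcomp Require Import all_classical all_reals all_analysis.

Set Implicit Arguments.
Unset Strict Implicit.
Unset Printing Implicit Defensive.

Import Order.TTheory GRing.Theory Num.Theory.
Import numFieldNormedType.Exports.

Local Open Scope complex_scope.
Local Open Scope classical_set_scope.
Local Open Scope ring_scope.

(* Complex Hilbert spaces; [dotp] is linear in its first argument.  Norms of
   vectors are (real) elements of R[i]. *)
HB.mixin Record isHilbert (R : realType) H of CompleteNormedModule R[i] H := {
  dotp : {dot H for @Num.conj R[i]};
  dotpE : forall x : H, dotp x x = `|x| ^+ 2 }.

#[short(type="hilbertType")]
HB.structure Definition Hilbert (R : realType) :=
  {H of isHilbert R H & CompleteNormedModule R[i] H}.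

Section FiniteDimension.
Variables (R : realType) (H : hilbertType R).

Definition is_basis (V : set H) (n : nat) (e : 'I_n -> H) : Prop :=
  (forall c : 'I_n -> R[i], \sum_i c i *: e i = 0 -> forall i, c i = 0) /\
  (forall x, V x <-> exists c : 'I_n -> R[i], x = \sum_i c i *: e i).

Definition finite_dim (V : set H) : Prop :=
  exists n (e : 'I_n -> H), is_basis V e.

(* 0 when V is not a finite-dimensional subspace *)
Definition dim (V : set H) : nat :=
  xget 0%N [set n | exists e : 'I_n -> H, is_basis V e].

(* The trace of T restricted to a finite-dimensional T-invariant subspace V,
   computed from the matrix of T in a basis of V. *)
Definition trace_on (T : H -> H) (V : set H) : R[i] :=
  xget 0 [set c | exists n (e : 'I_n -> H) (M : 'M[R[i]]_n),
    [/\ is_basis V e,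
        forall j, T (e j) = \sum_i M i j *: e i
      & c = \tr M]].

End FiniteDimension.

Section Operators.
Variables (R : realType) (H : hilbertType R).

(* A possibly unbounded operator; the values of [fct] outside [dom] are
   irrelevant. *)
Record operator := Operator { dom : set H ; fct :> H -> H }.

Definition everywhere (T : H -> H) : operator := Operator setT T.

Definition restr (S : operator) (K : set H) : operator :=
  Operator (dom S `&` K) S.

Definition linear_operator (S : operator) : Prop :=
  dom S 0 /\
  forall (c : R[i]) x y, dom S x -> dom S y ->
    dom S (c *: x + y) /\ S (c *: x + y) = c *: S x + S y.

(* (y, z) is in the graph of the adjoint of S *)
Definition adjoint_graph (S : operator) (y z : H) : Prop :=
  forall x, dom S x -> dotp (S x) y = dotp x z.

Definition self_adjoint (S : operator) : Prop :=
  [/\ linear_operator S, dense (dom S)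
    & forall y z, adjoint_graph S y z <-> dom S y /\ S y = z].

(* Fredholmness of a densely defined closed operator (in particular of a
   self-adjoint one). *)
Definition fredholm (S : operator) : Prop :=
  [/\ finite_dim [set x | dom S x /\ S x = 0],
      closed (S @` dom S)
    & exists V, finite_dim V /\
        forall y, exists x v, [/\ dom S x, V v & y = S x + v]].

Definition unitary (g : H -> H) : Prop :=
  [/\ linear g, forall y, exists x, g x = y
    & forall x y, dotp (g x) (g y) = dotp x y].

(* The bounded operator g commutes with S: gS is contained in Sg. *)
Definition commutes_with (g : H -> H) (S : operator) : Prop :=
  forall x, dom S x -> dom S (g x) /\ S (g x) = g (S x).

Definition Eig (S : operator) : set R[i] :=
  [set l | exists x, [/\ dom S x, x != 0 & S x = l *: x]].

Definition norm_continuous_on (D : set R) (F : R -> H -> H) : Prop :=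
  forall s, D s -> forall eps : R, 0 < eps ->
  exists2 delta : R, 0 < delta &
    forall t, D t -> `|t - s| < delta ->
    forall x, `|F t x - F s x| <= eps%:C * `|x|.

(* T is the everywhere defined inverse of S + c *)
Definition inverse_shift (S : operator) (c : R[i]) (T : H -> H) : Prop :=
  (forall y, dom S (T y) /\ S (T y) + c *: T y = y) /\
  (forall x, dom S x -> T (S x + c *: x) = x).

Definition gap_continuous (A : R -> operator) : Prop :=
  exists Res : R -> H -> H,
    (forall t, `[0, 1]%classic t -> inverse_shift (A t) 'i (Res t)) /\
    norm_continuous_on `[0, 1]%classic Res.

End Operators.

(* The complex numbers with their Borel sigma-algebra *)
Definition borelC (R : realType) :=
  g_sigma_algebraType (@open R[i]^o).

Section SpectralMeasures.
Variables (R : realType) (H : hilbertType R).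

Definition orthogonal_projection (P : H -> H) : Prop :=
  [/\ linear P, forall x, P (P x) = P x
    & forall x y, dotp (P x) y = dotp x (P y)].

(* A projection-valued measure on the closed subspace K of H.  An operator on K
   is identified with its extension by 0 to the orthogonal complement of K, so
   that E setT is the orthogonal projection onto K. *)
Definition projection_valued_measure d (T : measurableType d) (K : set H)
    (E : set T -> H -> H) : Prop :=
  [/\ forall I, measurable I -> orthogonal_projection (E I),
      range (E setT) = K,
      forall I J, measurable I -> measurable J ->
        forall x, E (I `&` J) x = E I (E J x)
    & forall F : nat -> set T, (forall n, measurable (F n)) ->
        trivIset setT F ->
        forall x, (fun n => \sum_(k < n) E (F k) x) @ \oo -->
                  E (\bigcup_n F n) x].

(* The scalar measure I |-> <E(I)x, x> *)
Definition scalar_measure d (T : measurableType d) (E : set T -> H -> H)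
    (x : H) : set T -> \bar R :=
  fun I => (complex.Re (dotp (E I x) x))%:E.

Definition cintegral d (T : measurableType d) (mu : set T -> \bar R)
    (f : T -> R[i]) : R[i] :=
  (fine (\int[mu]_w (complex.Re (f w))%:E))%:C +
  'i * (fine (\int[mu]_w (complex.Im (f w))%:E))%:C.

(* S = \int f dE as operators on the closed subspace K:
   dom S = {x in K | \int |f|^2 d<Ex,x> < oo} and
   <Sx,x> = \int f d<Ex,x> for x in dom S, which determines S by polarization. *)
Definition is_spectral_integral d (T : measurableType d) (f : T -> R[i])
    (K : set H) (E : set T -> H -> H) (S : operator H) : Prop :=
  (forall x, dom S x <->
     K x /\ (\int[scalar_measure E x]_w
               (complex.Re (f w) ^+ 2 + complex.Im (f w) ^+ 2)%:E < +oo)%E) /\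
  (forall x, dom S x ->
     K (S x) /\ dotp (S x) x = cintegral (scalar_measure E x) f).

(* E is the spectral measure of the normal operator S on the Hilbert space K,
   i.e. E I = P_I(S) for every Borel set I of complex numbers. *)
Definition spectral_measure (K : set H) (S : operator H)
    (E : set (borelC R) -> H -> H) : Prop :=
  projection_valued_measure K E /\
  is_spectral_integral (fun z : borelC R => z : R[i]) K E S.

(* The same for a self-adjoint S, whose spectral measure lives on the line. *)
Definition sa_spectral_measure (K : set H) (S : operator H)
    (E : set R -> H -> H) : Prop :=
  projection_valued_measure K E /\
  is_spectral_integral (fun r : R => r%:C) K E S.

End SpectralMeasures.

Section SpectralFlow.
Variables (R : realType) (H : hilbertType R).

(* Times t_0, ..., t_n and levels a_1, ..., a_n; the values of [time] and
   [level] at other indices are irrelevant. *)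
Record partition_data := PartitionData
  { size_part : nat ; time : nat -> R ; level : nat -> R }.

(* In this section E t I stands for P_I(A(t)), and its range for E_I(A(t)). *)
Definition flow_partition (E : R -> set R -> H -> H) (p : partition_data) :
    Prop :=
  let n := size_part p in let t := time p in let a := level p in
  [/\ t 0%N = 0, t n = 1, forall k, (1 <= k <= n)%N -> t k.-1 < t k
    & forall k, (1 <= k <= n)%N ->
      [/\ 0 <= a k,
          forall s, `[t k.-1, t k]%classic s ->
            finite_dim (range (E s `[- a k, a k]%classic))
        & norm_continuous_on `[t k.-1, t k]%classic
            (fun s => E s `[- a k, a k]%classic)]].

Definition sf_partition (E : R -> set R -> H -> H) (p : partition_data) : int :=
  \sum_(1 <= k < (size_part p).+1)
    ((dim (range (E (time p k) `[0, level p k]%classic)))%:Z -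
     (dim (range (E (time p k.-1) `[0, level p k]%classic)))%:Z).

(* The spectral flow of a family B of self-adjoint operators on the closed
   subspace K of H: the common value of [sf_partition] over all flow
   partitions of B. *)
Definition sf (K : set H) (B : R -> operator H) : int :=
  xget 0 [set s | exists (E : R -> set R -> H -> H) p,
    [/\ forall t, `[0, 1]%classic t -> sa_spectral_measure K (B t) (E t),
        flow_partition E p & s = sf_partition E p]].

Definition sf_gamma_partition (gamma : H -> H) (E : R -> set R -> H -> H)
    (p : partition_data) : R[i] :=
  \sum_(1 <= k < (size_part p).+1)
    (trace_on gamma (range (E (time p k) `[0, level p k]%classic)) -
     trace_on gamma (range (E (time p k.-1) `[0, level p k]%classic))).

End SpectralFlow.

(* Main.v *)
(* Since [gamma] commutes with [A t], it commutes with the spectral measure [E t]: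
   if [0 <= T <= rho] on a spectral subspace [V] and [T >= sigma > rho] on a spectral
   subspace [W], where [T = +-(A t - m)], then for x in V and Q the projection onto W,
   [sigma^n |Q gamma x| <= |T^n Q gamma x| = |Q gamma T^n x| <= rho^n |x|], so
   [Q gamma x = 0].  The same argument with the identity in place of [gamma] gives the
   uniqueness of spectral measures.  Hence [E t] followed by the projection onto
   [ker (gamma - l)] is the spectral measure of the restriction of [A t] to this kernel,
   and diagonalizing [gamma] on the finite-dimensional ranges of [E t `[0, a]] expresses
   each trace as the sum over [l] of [l] times the dimension of the [l]-eigenspace.

   What remains is that the spectral flow of the restrictions does not depend on the flow
   partition.  On a common subinterval with levels [a <= b] the jumps differ by the change
   of the rank of [E t `]a, b]].  The form [Re <(A t + i)^-1 x, x>] is continuous in [t],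
   positive on the range of [E t `]a, b]] and negative on that of [E t `[-b, -a[], so both
   ranks are lower semicontinuous; their sum is locally constant, hence so are they. *)
Require Import Defs.
From HB Require Import structures.
From mathcomp Require Import all_boot all_order all_algebra.
From mathcomp Require Import complex.
From mathcomp Require Import all_classical all_reals all_analysis.
From mathcomp Require Import measurable_realfun.
From mathcomp Require Import ring lra.
Import Order.TTheory GRing.Theory Num.Theory.
Import numFieldNormedType.Exports.

Set Implicit Arguments.
Unset Strict Implicit.
Unset Printing Implicit Defensive.

Local Open Scope complex_scope.
Local Open Scope classical_set_scope.
Local Open Scope ring_scope.

(* [dim] of vector.v shadows the one of [Defs]. *)
Local Notation dim := Defs.dim.

(** * Inner product and bounded operators *)

(** A flow partition only controls the symmetric windows [[-a, a]]: eigenvalues cross 0, so the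
    projections on [[0, a]] may jump, and nothing is assumed on one-sided bands. The difference of
    two windows is continuous but mixes the positive band with the negative one. The sign of [A t]
    has to separate them without its unbounded form, whose domain may move with [t]. The resolvent
    does this: if [x = (A t + i) z], then [Re <z, x> = <A t z, z>]. At level [a = 0] a uniform lower
    bound on []0, b]] is not automatic; finite rank supplies it.

    On the spectral side, [is_spectral_integral] gives only the domain and the diagonal of the form,
    so even the commutation of an operator with its own spectral measure has to be derived. Measures
    live on a subspace [K] throughout, since the argument must also apply to the restrictions.
    Evaluating [sf] needs both uniqueness of the spectral measure and independence of the partition,
    because [sf] may pick any admissible pair. Independence of the gamma-flow then follows from the
    formula, whose right-hand side does not mention the partition. *)

Section InnerProduct.
Variables (R : realType) (H : hilbertType R).
Implicit Types (x y z : H) (c : R[i]).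

Lemma dotpDl x y z : dotp (x + y) z = dotp x z + dotp y z.
Proof. by rewrite linearDl. Qed.

Lemma dotpDr x y z : dotp x (y + z) = dotp x y + dotp x z.
Proof. by rewrite linearDr. Qed.

Lemma dotpZl c x y : dotp (c *: x) y = c * dotp x y.
Proof. by rewrite linearZl_LR. Qed.

Lemma dotpZr c x y : dotp x (c *: y) = c^*%C * dotp x y.
Proof. by rewrite linearZr_LR. Qed.

Lemma dotpNl x y : dotp (- x) y = - dotp x y.
Proof. by rewrite linearNl. Qed.

Lemma dotpNr x y : dotp x (- y) = - dotp x y.
Proof. by rewrite linearNr. Qed.

Lemma dotp0l x : dotp 0 x = 0.
Proof. by rewrite linear0l. Qed.

Lemma dotp0r x : dotp x 0 = 0.
Proof. by rewrite linear0r. Qed.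

Lemma dotpC x y : dotp x y = (dotp y x)^*%C.
Proof. by rewrite hermC expr0 mul1r. Qed.

(** Norms and inner products live in [R[i]]; these real-valued versions put the estimates within
    reach of [lra] and [nra]. *)
Definition rdot x y : R := complex.Re (dotp x y).
Definition rn x : R := complex.Re `|x|.

Lemma normE x : `|x| = (rn x)%:C.
Proof. by rewrite /rn RRe_real // ger0_real. Qed.

Lemma rn_ge0 x : 0 <= rn x.
Proof. by rewrite -ler0c -normE. Qed.

Lemma rn0 : rn 0 = 0.
Proof. by rewrite /rn normr0. Qed.

Lemma dotpxx x : dotp x x = (rn x ^+ 2)%:C.
Proof. by rewrite dotpE normE -rmorphXn. Qed.

Lemma rdotxx x : rdot x x = rn x ^+ 2.
Proof. by rewrite /rdot dotpxx. Qed.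

Lemma rn_eq0 x : rn x = 0 -> x = 0.
Proof. by move=> h; apply/eqP; rewrite -normr_eq0 normE h. Qed.

Lemma rn_sq_eq0 x : rn x ^+ 2 = 0 -> x = 0.
Proof. by move/eqP; rewrite expf_eq0 /= => /eqP/rn_eq0. Qed.

Lemma rn_gt0 x : x != 0 -> 0 < rn x.
Proof. by move=> x0; rewrite lt_neqAle rn_ge0 andbT eq_sym; apply: contra_neq x0; exact: rn_eq0. Qed.

Lemma dotpxx_eq0 x : dotp x x = 0 -> x = 0.
Proof. by move=> h; apply: rn_sq_eq0; rewrite -rdotxx /rdot h. Qed.

Lemma rnD x y : rn (x + y) <= rn x + rn y.
Proof. by rewrite -lecR rmorphD /= -!normE ler_normD. Qed.

Lemma rnN x : rn (- x) = rn x.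
Proof. by rewrite /rn normrN. Qed.

Lemma rnB x y : rn (x - y) = rn (y - x).
Proof. by rewrite -rnN opprB. Qed.

Lemma rnZ c x : rn (c *: x) = complex.Re `|c| * rn x.
Proof.
apply: (@complexI R); rewrite -normE normrZ rmorphM /= -normE.
by congr (_ * _); rewrite RRe_real // ger0_real.
Qed.

Lemma rdotDl x y z : rdot (x + y) z = rdot x z + rdot y z.
Proof. by rewrite /rdot dotpDl raddfD. Qed.

Lemma rdotDr x y z : rdot x (y + z) = rdot x y + rdot x z.
Proof. by rewrite /rdot dotpDr raddfD. Qed.

Lemma rdotNl x y : rdot (- x) y = - rdot x y.
Proof. by rewrite /rdot dotpNl raddfN. Qed.

Lemma rdotNr x y : rdot x (- y) = - rdot x y.
Proof. by rewrite /rdot dotpNr raddfN. Qed.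

Lemma rdotC x y : rdot x y = rdot y x.
Proof. by rewrite /rdot dotpC; case: (dotp y x). Qed.

Lemma rdotZl (r : R) x y : rdot (r%:C *: x) y = r * rdot x y.
Proof. by rewrite /rdot dotpZl; case: (dotp x y) => a b /=; rewrite mul0r subr0. Qed.

Lemma rdotZr (r : R) x y : rdot x (r%:C *: y) = r * rdot x y.
Proof. by rewrite rdotC rdotZl rdotC. Qed.

Lemma rdotiZl x y : rdot ((Complex 0 1) *: x) y = - complex.Im (dotp x y).
Proof. by rewrite /rdot dotpZl; case: (dotp x y) => a b /=; rewrite mul0r mul1r sub0r. Qed.

Lemma rnD_sq x y : rn (x + y) ^+ 2 = rn x ^+ 2 + 2 * rdot x y + rn y ^+ 2.
Proof. rewrite -!rdotxx !rdotDl !rdotDr (rdotC y x); ring. Qed.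

Lemma pythagoras x y : dotp x y = 0 -> rn (x + y) ^+ 2 = rn x ^+ 2 + rn y ^+ 2.
Proof. by move=> h; rewrite rnD_sq /rdot h /= mulr0 addr0. Qed.

(** Cauchy-Schwarz for the real part: the squared norm of [rn y x - rn x y] expands to
    [2 rn x rn y (rn x rn y - rdot x y)]. *)
Lemma rdot_le x y : rdot x y <= rn x * rn y.
Proof.
have [->|x0] := eqVneq x 0; first by rewrite /rdot dotp0l rn0 mul0r.
have [->|y0] := eqVneq y 0; first by rewrite /rdot dotp0r rn0 mulr0.
have px := rn_gt0 x0; have py := rn_gt0 y0.
have := sqr_ge0 (rn ((rn y)%:C *: x - (rn x)%:C *: y)).
rewrite -rdotxx !(rdotDl, rdotDr, rdotNl, rdotNr, rdotZl, rdotZr) !rdotxx (rdotC y x) => h.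
have pxy : 0 < rn x * rn y by rewrite mulr_gt0.
rewrite -(ler_pM2l pxy); nra.
Qed.

Lemma rdot_abs_le x y : `|rdot x y| <= rn x * rn y.
Proof.
rewrite ler_norml rdot_le andbT lerNl -rdotNl.
by rewrite (le_trans (rdot_le _ _))// rnN.
Qed.

Lemma cvgH (u : nat -> H) (l : H) :
  u @ \oo --> l <-> forall e : R, 0 < e -> \forall n \near \oo, rn (l - u n) < e.
Proof.
split.
  move=> /cvgrPdist_lt h e e0.
  have e0' : 0 < e%:C by rewrite ltcR.
  by have := h _ e0'; apply: filterS => n; rewrite normE ltcR.
move=> h; apply/cvgrPdist_lt => e e0.
have eE : e = (complex.Re e)%:C by rewrite RRe_real // gtr0_real.
rewrite eE in e0 *; rewrite ltcR in e0.
by have := h _ e0; apply: filterS => n; rewrite normE ltcR.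
Qed.

Lemma cvgH_rdot (u : nat -> H) (l y : H) :
  u @ \oo --> l -> (fun n => rdot (u n) y) @ \oo --> rdot l y.
Proof.
move=> /cvgH h; apply/cvgrPdist_lt => e e0.
have p : 0 < rn y + 1 by rewrite ltr_wpDl// rn_ge0.
have := h (e / (rn y + 1)) (divr_gt0 e0 p); apply: filterS => n.
rewrite ltr_pdivlMr// => hn.
rewrite -rdotNl -rdotDl (le_lt_trans (rdot_abs_le _ _))//.
rewrite (le_lt_trans _ hn)// ler_wpM2l ?rn_ge0// lerDl//.
Qed.

Lemma cvgH_linear (P : H -> H) (C : R) (u : nat -> H) (l : H) :
  linear P -> (forall x, rn (P x) <= C * rn x) ->
  u @ \oo --> l -> (P \o u) @ \oo --> P l.
Proof.
move=> lP bP /cvgH h; apply/cvgH => e e0.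
have p : 0 < `|C| + 1 by rewrite ltr_wpDl.
have := h (e / (`|C| + 1)) (divr_gt0 e0 p); apply: filterS => n.
rewrite ltr_pdivlMr// => hn /=.
have -> : P l - P (u n) = P (l - u n).
  by rewrite -(scaleN1r (u n)) (addrC l) lP scaleN1r addrC.
rewrite (le_lt_trans (bP _))// (le_lt_trans _ hn)// mulrC ler_wpM2l ?rn_ge0//.
by rewrite (le_trans (ler_norm C))// lerDl.
Qed.

Lemma cvgH_unique (u : nat -> H) (l l' : H) :
  u @ \oo --> l -> u @ \oo --> l' -> l = l'.
Proof.
move=> /cvgH h /cvgH h'; apply/eqP; rewrite -subr_eq0; apply/eqP/rn_eq0.
apply/eqP; rewrite eq_le rn_ge0 andbT; apply/ler_addgt0Pl => e e0; rewrite addr0.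
have e2 : 0 < e / 2 by rewrite divr_gt0.
have [n [hn hn']] := filter_ex (filterI (h _ e2) (h' _ e2)).
rewrite -(subrKA (u n)) (le_trans (rnD _ _))// (rnB (u n)); lra.
Qed.

Definition subspace (V : set H) : Prop :=
  V 0 /\ forall c x y, V x -> V y -> V (c *: x + y).

Section Subspace.
Variables (V : set H) (sV : subspace V).

Lemma subspaceD x y : V x -> V y -> V (x + y).
Proof. by move=> hx hy; rewrite -(scale1r x); apply: sV.2. Qed.

Lemma subspaceZ c x : V x -> V (c *: x).
Proof. by move=> hx; rewrite -(addr0 (_ *: _)); apply: sV.2 => //; exact: sV.1. Qed.

Lemma subspaceN x : V x -> V (- x).
Proof. by move=> hx; rewrite -scaleN1r; exact: subspaceZ. Qed.

Lemma subspaceB x y : V x -> V y -> V (x - y).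
Proof. by move=> hx hy; apply: subspaceD => //; exact: subspaceN. Qed.

Lemma subspace_sum (I : finType) (F : I -> H) :
  (forall i, V (F i)) -> V (\sum_i F i).
Proof. by move=> h; elim/big_ind : _ => //; [exact: sV.1|exact: subspaceD]. Qed.

End Subspace.

Section LinearFun.
Variables (P : H -> H) (lP : linear P).

Lemma linfD x y : P (x + y) = P x + P y.
Proof. by rewrite -{1}(scale1r x) lP scale1r. Qed.

Lemma linf0 : P 0 = 0.
Proof. by apply: (@addIr _ (P 0)); rewrite -linfD !add0r. Qed.

Lemma linfZ c x : P (c *: x) = c *: P x.
Proof. by rewrite -{1}(addr0 (c *: x)) lP linf0 addr0. Qed.

Lemma linfN x : P (- x) = - P x.
Proof. by rewrite -scaleN1r linfZ scaleN1r. Qed.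

Lemma linfB x y : P (x - y) = P x - P y.
Proof. by rewrite linfD linfN. Qed.

Lemma linf_sum (I : Type) (r : seq I) (Q : pred I) (F : I -> H) :
  P (\sum_(i <- r | Q i) F i) = \sum_(i <- r | Q i) P (F i).
Proof. exact: (big_morph P linfD linf0). Qed.

End LinearFun.

Section OrthogonalProjection.
Variables (P : H -> H) (oP : orthogonal_projection P).

Let lP : linear P. Proof. by case: oP. Qed.

Lemma oproj_idem x : P (P x) = P x. Proof. by case: oP. Qed.

Lemma oproj_sym x y : dotp (P x) y = dotp x (P y). Proof. by case: oP. Qed.

Lemma oproj_rangeP x : range P x <-> P x = x.
Proof. by split=> [[y _ <-]|<-]; [exact: oproj_idem|exists x]. Qed.

Lemma oproj_range_subspace : subspace (range P).
Proof.
split=> [|c x y /oproj_rangeP hx /oproj_rangeP hy]; first by exists 0; rewrite ?linf0.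
by apply/oproj_rangeP; rewrite lP hx hy.
Qed.

Lemma oproj_dot x : dotp (P x) x = (rn (P x) ^+ 2)%:C.
Proof. by rewrite -dotpxx [RHS]oproj_sym oproj_idem -oproj_sym. Qed.

Lemma oproj_le x : rn (P x) <= rn x.
Proof.
rewrite -ler_sqr ?nnegrE ?rn_ge0//.
have -> : rn x ^+ 2 = rn (P x + (x - P x)) ^+ 2 by rewrite addrC subrK.
rewrite pythagoras ?lerDl ?sqr_ge0//.
by rewrite dotpDr dotpNr oproj_dot dotpxx subrr.
Qed.

Lemma oproj_le1 x : rn (P x) <= 1 * rn x.
Proof. by rewrite mul1r oproj_le. Qed.

End OrthogonalProjection.

(** Equal fixed spaces give [Q P = P] and [P Q = Q], and then the four terms of
    [<P x - Q x, P x - Q x>] cancel in pairs. *)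
Lemma oproj_range_inj (P Q : H -> H) :
  orthogonal_projection P -> orthogonal_projection Q ->
  (forall x, P x = x <-> Q x = x) -> forall x, P x = Q x.
Proof.
move=> oP oQ h x; have QP : Q (P x) = P x by apply/h; exact: oproj_idem.
have PQ : P (Q x) = Q x by apply/h; exact: oproj_idem.
apply/eqP; rewrite -subr_eq0; apply/eqP/dotpxx_eq0.
have lP : linear P by case: oP.
have lQ : linear Q by case: oQ.
have e1 : forall z, dotp (P x) (P z) = dotp x (P z).
  by move=> z; rewrite oproj_sym// oproj_idem.
have e2 : dotp (P x) (Q x) = dotp x (Q x) by rewrite oproj_sym// PQ.
have e3 : dotp (Q x) (P x) = dotp x (P x) by rewrite oproj_sym// QP.
have e4 : dotp (Q x) (Q x) = dotp x (Q x) by rewrite oproj_sym// oproj_idem.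
rewrite dotpDl dotpNl !dotpDr !dotpNr e1 e2 e3 e4; ring.
Qed.

End InnerProduct.

(** * Projection-valued measures *)

Section RawIntegral.
Context d (T : measurableType d) (R : realType).
Import HBNNSimple.

(** The integral accepts any set function and evaluates it only on level sets of simple functions,
    which are measurable. This allows [scalar_measure], uncontrolled off the measurable sets, to be
    replaced by a genuine measure. *)
Lemma eq_integral_raw (m1 m2 : set T -> \bar R) (g : T -> \bar R) :
  (forall A, measurable A -> m1 A = m2 A) ->
  (\int[m1]_w g w = \int[m2]_w g w)%E.
Proof.
move=> m12; have e : (fun h : {nnsfun T >-> R} => sintegral m1 h) =
                     (fun h : {nnsfun T >-> R} => sintegral m2 h).
  apply/funext => h; rewrite /sintegral; apply: eq_fsbigr => r _.
  by rewrite m12// -[X in measurable X]setTI; exact: measurable_funP.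
by rewrite /integral e.
Qed.

End RawIntegral.

Section Pvm.
Context d (T : measurableType d) (R : realType) (H : hilbertType R).
Variables (K : set H) (E : set T -> H -> H).
Hypothesis pvm : projection_valued_measure K E.
Implicit Types (x y z : H) (A B : set T).

Lemma pvm_oproj A : measurable A -> orthogonal_projection (E A).
Proof. by case: pvm => h _ _ _; exact: h. Qed.

Lemma pvm_linear A : measurable A -> linear (E A).
Proof. by move=> /pvm_oproj[]. Qed.

Lemma pvmI A B x : measurable A -> measurable B -> E (A `&` B) x = E A (E B x).
Proof. by case: pvm => _ _ h _ mA mB; exact: h. Qed.

Lemma pvmT x : K x <-> E setT x = x.
Proof.
have oE : orthogonal_projection (E setT) by exact: pvm_oproj.
by rewrite -(oproj_rangeP oE); case: pvm => _ ->.
Qed.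

Lemma pvm_idem A x : measurable A -> E A (E A x) = E A x.
Proof. by move=> mA; rewrite -pvmI// setIid. Qed.

Lemma pvmK A x : measurable A -> K (E A x).
Proof. by move=> mA; apply/pvmT; rewrite -pvmI// setTI. Qed.

Lemma pvm_mem A x : measurable A -> E A x = x -> K x.
Proof. by move=> mA <-; exact: pvmK. Qed.

Lemma pvm_subspace : subspace K.
Proof.
by case: pvm => _ <- _ _; apply: oproj_range_subspace; exact: pvm_oproj.
Qed.

Lemma pvm_comm A B x : measurable A -> measurable B -> E A (E B x) = E B (E A x).
Proof. by move=> mA mB; rewrite -!pvmI// setIC. Qed.

Lemma pvm_sub A B x : measurable A -> measurable B -> A `<=` B ->
  E A x = x -> E B x = x.
Proof. by move=> mA mB AB <-; rewrite -pvmI// setIC setIidl. Qed.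

Lemma pvm_sub0 A B x : measurable A -> measurable B -> A `<=` B ->
  E B x = 0 -> E A x = 0.
Proof.
move=> mA mB AB h; rewrite -(setIidl AB) pvmI// h linf0//.
exact: pvm_linear.
Qed.

Lemma pvm_sigma (F : nat -> set T) x : (forall n, measurable (F n)) ->
  trivIset setT F ->
  (fun n => \sum_(k < n) E (F k) x) @ \oo --> E (\bigcup_n F n) x.
Proof. by case: pvm => _ _ _ h mF tF; exact: h. Qed.

(** Sigma-additivity for the constant family [set0]: the partial sums satisfy [u n.+1 = u n + v], so
    their limit [v] satisfies [v = v + v]. *)
Lemma pvm_set0 x : E set0 x = 0.
Proof.
have := @pvm_sigma (fun=> set0) x (fun=> measurable0) (@trivIset_set0 _ _ _).
rewrite bigcup0//; set v := E set0 x; set u := (u in u @ _ --> _) => uv.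
have uS : (fun n => u n.+1) @ \oo --> v by rewrite (cvg_shiftS u).
have : (fun n => u n.+1) @ \oo --> v + v.
  have -> : (fun n => u n.+1) = (fun n => u n + v).
    by apply/funext => n; rewrite /u big_ord_recr.
  by apply: cvgD => //; exact: cvg_cst.
by move=> /(cvgH_unique uS) /eqP; rewrite -{1}(addr0 v) (inj_eq (addrI _)) eq_sym => /eqP.
Qed.

Lemma pvmU A B x : measurable A -> measurable B -> A `&` B = set0 ->
  E (A `|` B) x = E A x + E B x.
Proof.
move=> mA mB AB; have mF n : measurable (bigcup2 A B n).
  by case: n => [//|[|n]//=]; exact: measurable0.
have tF : trivIset setT (bigcup2 A B) by rewrite -trivIset_bigcup2.
have := pvm_sigma (x := x) mF tF; rewrite bigcup2E.
set u := (u in u @ _ --> _) => uv.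
have uS : (fun n => u (n + 2)%N) @ \oo --> E (A `|` B) x by rewrite (cvg_shiftn 2 u).
apply: cvgH_unique uS _.
have -> : (fun n => u (n + 2)%N) = (fun=> E A x + E B x); last exact: cvg_cst.
apply/funext => n; rewrite /u addn2 !big_ord_recl /= big1 ?addr0// => i _.
exact: pvm_set0.
Qed.

Lemma pvmC A x : measurable A -> K x -> E A x + E (~` A) x = x.
Proof.
move=> mA /pvmT {3}<-; rewrite -pvmU ?setICr ?setUv//.
exact: measurableC.
Qed.

Lemma pvm_eqC A x : measurable A -> K x -> E (~` A) x = 0 -> E A x = x.
Proof. by move=> mA Kx h; rewrite -[RHS](pvmC mA Kx) h addr0. Qed.

Lemma pvmC0 A x : measurable A -> E A x = x -> E (~` A) x = 0.
Proof.
move=> mA <-; rewrite -pvmI//; last exact: measurableC.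
by rewrite setICl pvm_set0.
Qed.

(** The union is first made disjoint by [seqDU], which shrinks each [F n]; this is why the
    hypothesis ranges over all measurable subsets of [F n]. Boundedness of [phi] carries the
    vanishing from the partial sums to their limit. *)
Lemma pvm_bigcup0 (H' : hilbertType R) (phi : H -> H') (C : R) (F : nat -> set T) x :
  linear phi -> (forall y, rn (phi y) <= C * rn y) ->
  (forall n, measurable (F n)) ->
  (forall n A, measurable A -> A `<=` F n -> phi (E A x) = 0) ->
  phi (E (\bigcup_n F n) x) = 0.
Proof.
move=> lphi bphi mF h.
have mS n : measurable (seqDU F n) by apply: measurableD => //; exact: bigsetU_measurable.
have := pvm_sigma (x := x) mS (trivIset_seqDU F); rewrite -seqDU_bigcup_eq.
move=> /cvgH hc; apply: rn_eq0; apply/eqP; rewrite eq_le rn_ge0 andbT.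
apply/ler_addgt0Pl => e e0; rewrite addr0.
have p : 0 < `|C| + 1 by rewrite ltr_wpDl.
have [n hn] := filter_ex (hc _ (divr_gt0 e0 p)).
have -> : phi (E (\bigcup_n F n) x) =
    phi (E (\bigcup_n F n) x - \sum_(k < n) E (seqDU F k) x).
  rewrite [X in _ = phi X]addrC -scaleN1r lphi.
  have -> : phi (\sum_(k < n) E (seqDU F k) x) = 0; last by rewrite scaler0 add0r.
  have phi0 : phi 0 = 0.
    by apply: (@addIr _ (phi 0)); rewrite add0r -{1}(scale1r (phi 0)) -lphi scaler0 addr0.
  have phiD a b : phi (a + b) = phi a + phi b.
    by rewrite -{1}(scale1r a) lphi scale1r.
  rewrite (big_morph phi phiD phi0) big1// => k _.
  by apply: (h k) => //; exact: subset_seqDU.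
rewrite (le_trans (bphi _))// (le_trans (ler_wpM2r (rn_ge0 _) (ler_norm C)))//.
move: hn; rewrite ltr_pdivlMr// => /ltW; apply: le_trans.
by rewrite mulrC ler_wpM2l ?rn_ge0// lerDl.
Qed.

Lemma pvm_bigcup0_id (F : nat -> set T) x : (forall n, measurable (F n)) ->
  (forall n, E (F n) x = 0) -> E (\bigcup_n F n) x = 0.
Proof.
move=> mF h; apply: (@pvm_bigcup0 H id 1) => //.
- by move=> y; rewrite mul1r.
- by move=> n A mA AF; exact: pvm_sub0 AF (h n).
Qed.

(* [E A] is unconstrained when [A] is not measurable, whereas a measure has to be
   nonnegative on all sets. *)
Definition pmeasure (_ : projection_valued_measure K E) x A : \bar R :=
  if pselect (measurable A) then (rn (E A x) ^+ 2)%:E else 0%E.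

Lemma pmeasureE x A : measurable A -> pmeasure pvm x A = (rn (E A x) ^+ 2)%:E.
Proof. by rewrite /pmeasure; case: pselect. Qed.

Lemma scalar_measureE x A : measurable A -> scalar_measure E x A = pmeasure pvm x A.
Proof.
move=> mA; rewrite pmeasureE// /scalar_measure (oproj_dot (pvm_oproj mA))//.
Qed.

Let pm0 x : pmeasure pvm x set0 = 0%E.
Proof. by rewrite pmeasureE// pvm_set0 rn0 expr0n. Qed.

Let pm_ge0 x A : (0 <= pmeasure pvm x A)%E.
Proof. by rewrite /pmeasure; case: pselect => [?|?]; rewrite ?lee_fin ?sqr_ge0. Qed.

Let pm_sigma x : semi_sigma_additive (pmeasure pvm x).
Proof.
move=> F mF tF mU.
have h := cvgH_rdot (y := x) (pvm_sigma (x := x) mF tF).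
rewrite -scalar_measureE//.
have -> : (fun n => (\sum_(0 <= i < n) pmeasure pvm x (F i))%E) =
    (fun n => (rdot (\sum_(k < n) E (F k) x) x)%:E).
  apply/funext => n; rewrite big_mkord.
  elim: n => [|n IHn]; first by rewrite !big_ord0 /rdot dotp0l.
  rewrite !big_ord_recr /= IHn rdotDl EFinD; congr (_ + _)%E.
  by rewrite -scalar_measureE.
by apply: cvg_EFin; [exact: nearW|].
Qed.

HB.instance Definition _ x := isMeasure.Build d T R (pmeasure pvm x)
  (pm0 x) (pm_ge0 x) (@pm_sigma x).

Let pm_fin x : fin_num_fun (pmeasure pvm x).
Proof. by move=> A mA; rewrite pmeasureE. Qed.

HB.instance Definition _ x := Measure_isFinite.Build d T R (pmeasure pvm x)
  (@pm_fin x).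

Lemma pmeasure_eq0 x A : measurable A -> pmeasure pvm x A = 0%E <-> E A x = 0.
Proof.
move=> mA; rewrite pmeasureE//; split => [[]/rn_sq_eq0//|->].
by rewrite rn0 expr0n.
Qed.

Lemma pmeasureT x : K x -> pmeasure pvm x setT = (rn x ^+ 2)%:E.
Proof. by move=> /pvmT Kx; rewrite pmeasureE// Kx. Qed.

End Pvm.

(** * Spectral integrals *)

Section SpectralIntegral.
Context d (T : measurableType d) (R : realType) (H : hilbertType R).
Variables (f : T -> R[i]) (K : set H) (E : set T -> H -> H) (S : operator H).
Hypothesis mRe : measurable_fun setT (fun w => complex.Re (f w)).
Hypothesis mIm : measurable_fun setT (fun w => complex.Im (f w)).
Hypothesis pvm : projection_valued_measure K E.
Hypothesis linS : linear_operator S.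
Hypothesis spi : is_spectral_integral f K E S.
Implicit Types (x y z : H) (A B : set T).

Let sq (w : T) : R := complex.Re (f w) ^+ 2 + complex.Im (f w) ^+ 2.

Let msq : measurable_fun setT sq.
Proof. by apply: measurable_funD; apply: measurable_funX. Qed.

Let sq_ge0 w : 0 <= sq w.
Proof. by rewrite addr_ge0 ?sqr_ge0. Qed.

Lemma dom_spi x : dom S x <-> K x /\ (\int[pmeasure pvm x]_w (sq w)%:E < +oo)%E.
Proof.
case: spi => h _; rewrite h (eq_integral_raw (m2 := pmeasure pvm x))//.
by move=> A mA; exact: scalar_measureE.
Qed.

Lemma dom_K x : dom S x -> K x. Proof. by move=> /dom_spi[]. Qed.

Lemma range_K x : dom S x -> K (S x).
Proof. by case: spi => _ h /h[]. Qed.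

Lemma dot_spi x : dom S x -> dotp (S x) x =
  Complex (fine (\int[pmeasure pvm x]_w (complex.Re (f w))%:E))
          (fine (\int[pmeasure pvm x]_w (complex.Im (f w))%:E)).
Proof.
case: spi => _ h /h[_ ->]; rewrite /cintegral.
rewrite !(eq_integral_raw (m1 := scalar_measure E x) (m2 := pmeasure pvm x));
  [|by move=> A mA; exact: scalar_measureE..].
by rewrite -complexiE [RHS]complexE.
Qed.

Lemma domP c x y : dom S x -> dom S y -> dom S (c *: x + y).
Proof. by move=> Sx Sy; case: linS => _ /(_ c x y Sx Sy)[]. Qed.

Lemma fctP c x y : dom S x -> dom S y -> S (c *: x + y) = c *: S x + S y.
Proof. by move=> Sx Sy; case: linS => _ /(_ c x y Sx Sy)[]. Qed.

Lemma dom0 : dom S 0. Proof. by case: linS. Qed.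

Lemma dom_subspace : subspace (dom S).
Proof. by split; [exact: dom0|exact: domP]. Qed.

Lemma fct0 : S 0 = 0.
Proof.
have := fctP 1 dom0 dom0; rewrite !scale1r addr0 => /eqP.
by rewrite -{1}(addr0 (S 0)) (inj_eq (addrI _)) eq_sym => /eqP.
Qed.

Lemma fctD x y : dom S x -> dom S y -> S (x + y) = S x + S y.
Proof. by move=> Sx Sy; have := fctP 1 Sx Sy; rewrite !scale1r. Qed.

Lemma fctZ c x : dom S x -> S (c *: x) = c *: S x.
Proof. by move=> Sx; have := fctP c Sx dom0; rewrite !addr0 fct0 addr0. Qed.

Lemma integrable_sq x : dom S x -> (pmeasure pvm x).-integrable setT (EFin \o sq).
Proof.
move=> /dom_spi[_ h]; apply/integrableP; split; first exact/measurable_EFinP.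
by under eq_integral do rewrite /= ger0_norm//.
Qed.

Lemma integrable_dominated (g : T -> R) x : dom S x -> measurable_fun setT g ->
  (forall w, `|g w| <= 1 + sq w) -> (pmeasure pvm x).-integrable setT (EFin \o g).
Proof.
move=> Sx mg hg.
apply: (@le_integrable _ _ _ (pmeasure pvm x) setT measurableT _ (EFin \o (fun w => 1 + sq w))).
- exact/measurable_EFinP.
- move=> w _ /=; rewrite lee_fin (le_trans (hg w))//.
  exact: ler_norm.
- apply: (@integrableD _ _ _ _ _ measurableT (EFin \o cst 1) (EFin \o sq)).
    exact: finite_measure_integrable_cst.
  exact: integrable_sq.
Qed.

Lemma integrable_Re x : dom S x ->
  (pmeasure pvm x).-integrable setT (EFin \o (fun w => complex.Re (f w))).
Proof.
move=> Sx; apply: integrable_dominated => // w.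
by rewrite /sq ler_norml; apply/andP; split; nra.
Qed.

Lemma integrable_Im x : dom S x ->
  (pmeasure pvm x).-integrable setT (EFin \o (fun w => complex.Im (f w))).
Proof.
move=> Sx; apply: integrable_dominated => // w.
by rewrite /sq ler_norml; apply/andP; split; nra.
Qed.

(** The components of [x] cut out by [A] and by its complement are orthogonal on every [B], so the
    scalar measure of [x] is the sum of theirs; the integral for [E A x] is at most the one for
    [x]. *)
Lemma domE A x : measurable A -> dom S x -> dom S (E A x).
Proof.
move=> mA /dom_spi[Kx hx]; apply/dom_spi; split; first exact: pvmK pvm _ _ mA.
have mC : measurable (~` A) by exact: measurableC.
apply: le_lt_trans hx.
pose m := measure_add (pmeasure pvm (E A x)) (pmeasure pvm (E (~` A) x)).
rewrite (@eq_measure_integral _ _ _ setT m (pmeasure pvm x)); last first.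
  move=> B mB _; transitivity (pmeasure pvm (E A x) B + pmeasure pvm (E (~` A) x) B)%E; last first.
    exact/esym/measure_addE.
  rewrite /= !pmeasureE//.
  rewrite -EFinD; congr EFin.
  have mBA : measurable (B `&` A) by exact: measurableI.
  have mBC : measurable (B `&` ~` A) by exact: measurableI.
  rewrite -!(pvmI pvm)//.
  have d0 : (B `&` A) `&` (B `&` ~` A) = set0 by rewrite -setIIr setICr setI0.
  have o : dotp (E (B `&` A) x) (E (B `&` ~` A) x) = 0.
    by rewrite (oproj_sym (pvm_oproj pvm mBA)) -(pvmI pvm _ mBA mBC) d0 (pvm_set0 pvm) dotp0r.
  by rewrite -(pythagoras o) -(pvmU pvm _ mBA mBC d0) -setIUr setUv setIT.
rewrite ge0_integral_measure_add//.
- by apply: leeDl; apply: integral_ge0 => w _; rewrite lee_fin.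
- by move=> w _; rewrite lee_fin.
- exact/measurable_EFinP.
Qed.

Lemma bounded_dom (M : R) A x : measurable A -> (forall w, A w -> sq w <= M) ->
  E A x = x -> dom S x.
Proof.
move=> mA hM EA; apply/dom_spi; split; first exact: pvm_mem pvm _ _ mA EA.
rewrite (ge0_negligible_integral (N := ~` A))//; first last.
- by apply/(pmeasure_eq0 pvm); [exact: measurableC|exact: pvmC0 pvm _ _ mA EA].
- by move=> w _; rewrite lee_fin.
- exact/measurable_EFinP.
- exact: measurableC.
rewrite setTD setCK.
apply: (@le_lt_trans _ _ (\int[pmeasure pvm x]_(w in A) (cst M%:E) w)%E).
  apply: ge0_le_integral => //.
  - by move=> w _; rewrite lee_fin.
  - by apply/measurable_EFinP; exact: measurable_funTS msq.
by rewrite integral_cst//= pmeasureE// -EFinM ltry.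
Qed.

Let polar0 (a b : R[i]) : a + b = 0 -> (Complex 0 (-1)) * a + (Complex 0 1) * b = 0 -> a = 0.
Proof.
case: a b => [a1 a2] [b1 b2] [h1 h2] [h3 h4].
by apply/eqP; rewrite eq_complex /=; apply/andP; split; apply/eqP; lra.
Qed.

(** Vanishing of the form at [c *: x + y] gives [c <h x, y> + conj c <h y, x> = 0]; the cases
    [c = 1] and [c = -i] together force [<h x, y> = 0]. *)
Lemma polarization (V : set H) (h : H -> H) :
  (forall c x y, V x -> V y -> V (c *: x + y)) ->
  (forall c x y, V x -> V y -> h (c *: x + y) = c *: h x + h y) ->
  (forall x, V x -> dotp (h x) x = 0) ->
  forall x y, V x -> V y -> dotp (h x) y = 0.
Proof.
move=> sV lh h0 x y Vx Vy.
have hc c : c * dotp (h x) y + c^*%C * dotp (h y) x = 0.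
  have := h0 _ (sV c x y Vx Vy).
  rewrite lh// dotpDl !dotpDr !dotpZl !dotpZr (h0 x)// (h0 y)// !mulr0.
  by rewrite add0r addr0.
apply: (@polar0 _ (dotp (h y) x)).
  by have := hc 1; rewrite conjc1 !mul1r.
have := hc (Complex 0 (-1)); rewrite /= opprK //.
Qed.

(* [y + c z] and [y - c z] have the same scalar spectral measure. *)
Lemma spi_orthogonal A y z : measurable A -> dom S y -> dom S z ->
  E A y = y -> E A z = 0 -> dotp (S y) z = 0 /\ dotp (S z) y = 0.
Proof.
move=> mA Sy Sz EAy EAz.
have orth B : measurable B -> dotp (E B y) z = 0.
  move=> mB; rewrite -{1}EAy (pvm_comm pvm)// (oproj_sym (pvm_oproj pvm mA)).
  by rewrite EAz dotp0r.
have same c : dotp (S (c *: z + y)) (c *: z + y) =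
    dotp (S (- c *: z + y)) (- c *: z + y).
  rewrite !dot_spi; [|exact: domP..].
  have e B : measurable B -> pmeasure pvm (c *: z + y) B = pmeasure pvm (- c *: z + y) B.
    move=> mB; rewrite !pmeasureE//; congr (_%:E).
    have lB := pvm_linear pvm mB.
    have o c' : dotp (c' *: E B z) (E B y) = 0.
      rewrite dotpZl -(oproj_sym (pvm_oproj pvm mB)) (pvm_idem pvm)//.
      by rewrite dotpC -(oproj_sym (pvm_oproj pvm mB)) orth// conjc0 mulr0.
    by rewrite !lB !pythagoras// !rnZ normrN.
  by rewrite !(eq_integral_raw (m1 := pmeasure pvm (c *: z + y)) _ e).
have hc c : c^*%C * dotp (S y) z + c * dotp (S z) y = 0.
  have := same c; rewrite !fctP// !dotpDl !dotpDr !dotpZl !dotpZr rmorphN /=.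
  set a := dotp (S z) z; set b := dotp (S y) y; set p := dotp (S z) y.
  set q := dotp (S y) z; set c' := c^*%C => h.
  have : 2%:R * (c' * q + c * p) = 0.
    have -> : 2%:R * (c' * q + c * p) = (c * (c' * a) + c * p + (c' * q + b)) -
       (- c * (- c' * a) + - c * p + (- c' * q + b)) by ring.
    by rewrite h subrr.
  by move/eqP; rewrite mulf_eq0 pnatr_eq0 /= => /eqP.
split.
  apply: (@polar0 _ (dotp (S z) y)); first by have := hc 1; rewrite conjc1 !mul1r.
  exact: (hc (Complex 0 1)).
apply: (@polar0 _ (dotp (S y) z)).
  by have := hc 1; rewrite conjc1 !mul1r addrC.
by have := hc (Complex 0 (-1)); rewrite /= opprK addrC.
Qed.

(** Slicing by the integer part of [|f|^2] makes [f] bounded on each slice, so every [E (F n) u]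
    lies in the domain and is orthogonal to [u], hence zero. *)
Lemma dom_dense u : K u -> (forall y, dom S y -> dotp u y = 0) -> u = 0.
Proof.
move=> Ku h.
pose F (k : nat) := sq @^-1` `[k%:R, k.+1%:R[%classic.
have mF k : measurable (F k) by rewrite /F -[X in measurable X]setTI; exact: msq.
have FU : \bigcup_k F k = setT.
  apply/seteqP; split => // w _; exists (Num.truncn (sq w)) => //=.
  by rewrite /F /preimage /= in_itv /= truncn_itv.
rewrite -[u](pvmT pvm u).1// -FU; apply: (pvm_bigcup0_id pvm mF) => n.
apply: dotpxx_eq0; rewrite (oproj_sym (pvm_oproj pvm (mF n))) (pvm_idem pvm)//.
apply: h; apply: (bounded_dom (M := n.+1%:R) (mF n)); last exact: pvm_idem pvm _ _ _.
by move=> w; rewrite /F /preimage /= in_itv /= => /andP[_ /ltW].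
Qed.

(** By [spi_orthogonal], [S (E B x)] is orthogonal to the part of every domain vector outside [B],
    so by density it has no component there. Applied to [A] and to its complement, this splits [S x]
    along [E A]. *)
Lemma spi_commute A x : measurable A -> dom S x -> S (E A x) = E A (S x).
Proof.
move=> mA Sx.
have mC : measurable (~` A) by exact: measurableC.
have main B : measurable B -> E (~` B) (S (E B x)) = 0.
  move=> mB; have mCB : measurable (~` B) by exact: measurableC.
  have SBx := domE mB Sx.
  apply: dom_dense; first exact: pvmK pvm _ _ mCB.
  move=> y Sy; rewrite (oproj_sym (pvm_oproj pvm mCB)).
  apply: (spi_orthogonal mB SBx (domE mCB Sy) _ _).1; first exact: pvm_idem pvm _ _ _.
  by rewrite -(pvmI pvm)// setICr (pvm_set0 pvm).
have hA : E A (S (E A x)) = S (E A x).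
  by apply: (pvm_eqC pvm mA) (main _ mA); apply: range_K; exact: domE.
have hC : E A (S (E (~` A) x)) = 0 by have := main _ mC; rewrite setCK.
have {2}<- := pvmC pvm mA (dom_K Sx).
rewrite fctD ?linfD ?hA ?hC ?addr0//.
- exact: pvm_linear pvm _ mA.
- exact: domE.
- exact: domE.
Qed.

End SpectralIntegral.

(** * Form bounds and eigenvectors of spectral integrals *)

Section SpectralCalculus.
Context d (T : measurableType d) (R : realType) (H : hilbertType R).
Variables (f : T -> R[i]) (K : set H) (E : set T -> H -> H) (S : operator H).
Hypothesis mRe : measurable_fun setT (fun w => complex.Re (f w)).
Hypothesis mIm : measurable_fun setT (fun w => complex.Im (f w)).
Hypothesis pvm : projection_valued_measure K E.
Hypothesis linS : linear_operator S.
Hypothesis spi : is_spectral_integral f K E S.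
Implicit Types (x y z : H) (A B : set T) (g : T -> R).

Lemma pmeasure_int_le g A x (b : R) : measurable A ->
  (pmeasure pvm x).-integrable setT (EFin \o g) -> E A x = x ->
  (forall w, A w -> g w <= b) ->
  fine (\int[pmeasure pvm x]_w (g w)%:E) <= b * rn x ^+ 2.
Proof.
move=> mA ig EA hb; have mC : measurable (~` A) by exact: measurableC.
rewrite -lee_fin fineK; last exact: integrable_fin_num ig.
rewrite (negligible_integral (N := ~` A))//; last first.
  by apply/(pmeasure_eq0 pvm) => //; exact: pvmC0 pvm _ _ mA EA.
rewrite setTD setCK.
have igA : (pmeasure pvm x).-integrable A (EFin \o g) by exact: integrableS ig.
have icA : (pmeasure pvm x).-integrable A (EFin \o cst b).
  exact: finite_measure_integrable_cst.
apply: (@le_trans _ _ (\int[pmeasure pvm x]_(w in A) (cst b%:E) w)%E).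
  by apply: le_integral => // w; rewrite inE => Aw; rewrite lee_fin hb.
by rewrite integral_cst//= pmeasureE// EA.
Qed.

Lemma pmeasure_int_ge g A x (b : R) : measurable A ->
  (pmeasure pvm x).-integrable setT (EFin \o g) -> E A x = x ->
  (forall w, A w -> b <= g w) ->
  b * rn x ^+ 2 <= fine (\int[pmeasure pvm x]_w (g w)%:E).
Proof.
move=> mA ig EA hb.
have iN : (pmeasure pvm x).-integrable setT (EFin \o (fun w => - g w)).
  have -> : EFin \o (fun w => - g w) = (\- (EFin \o g))%E by apply/funext.
  exact: integrableN.
have hN w : A w -> - g w <= - b by move=> Aw; rewrite lerN2 hb.
have := pmeasure_int_le mA iN EA hN.
rewrite [X in fine X](_ : _ = - \int[pmeasure pvm x]_w (g w)%:E)%E; last first.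
  rewrite -integralN; last exact: integrable_add_def.
  by apply: eq_integral.
by rewrite fineN mulNr lerN2.
Qed.

Lemma pmeasure_int_cst g A x (b : R) : measurable A ->
  (pmeasure pvm x).-integrable setT (EFin \o g) -> E A x = x ->
  (forall w, A w -> g w = b) ->
  fine (\int[pmeasure pvm x]_w (g w)%:E) = b * rn x ^+ 2.
Proof.
move=> mA ig EA hb; apply/eqP; rewrite eq_le.
rewrite (pmeasure_int_le mA ig EA) ?(pmeasure_int_ge mA ig EA)// => w /hb ->//.
Qed.

Lemma rdot_spi x : dom S x ->
  rdot (S x) x = fine (\int[pmeasure pvm x]_w (complex.Re (f w))%:E).
Proof. by move=> Sx; rewrite /rdot (dot_spi pvm spi). Qed.

Lemma spi_le A x (b : R) : measurable A -> dom S x -> E A x = x ->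
  (forall w, A w -> complex.Re (f w) <= b) -> rdot (S x) x <= b * rn x ^+ 2.
Proof.
move=> mA Sx EA hb; rewrite rdot_spi//; apply: pmeasure_int_le EA hb => //.
exact: (integrable_Re mRe mIm pvm spi).
Qed.

Lemma spi_ge A x (b : R) : measurable A -> dom S x -> E A x = x ->
  (forall w, A w -> b <= complex.Re (f w)) -> b * rn x ^+ 2 <= rdot (S x) x.
Proof.
move=> mA Sx EA hb; rewrite rdot_spi//; apply: pmeasure_int_ge EA hb => //.
exact: (integrable_Re mRe mIm pvm spi).
Qed.

(** On the range of [E A] the function [f] is the constant [l] almost everywhere, so the form of
    [S - l] vanishes there. The range is invariant under [S], so polarization may be applied with
    [S x - l *: x] itself as the second vector. *)
Lemma spi_eigenvector A (l : R[i]) x : measurable A ->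
  (forall w, A w -> f w = l) -> E A x = x -> dom S x /\ S x = l *: x.
Proof.
move=> mA hA; set V := [set y | E A y = y].
have VS y : V y -> dom S y.
  apply: (bounded_dom mRe mIm pvm spi (M := complex.Re l ^+ 2 + complex.Im l ^+ 2)) => //.
  by move=> w /hA ->.
have lE := pvm_linear pvm mA.
have sV c y z : V y -> V z -> V (c *: y + z) by rewrite /V /= lE => -> ->.
pose h y := S y - l *: y.
have h0 y : V y -> dotp (h y) y = 0.
  move=> Vy; rewrite /h dotpDl dotpNl dotpZl (dot_spi pvm spi (VS _ Vy)) dotpxx.
  rewrite (pmeasure_int_cst mA (integrable_Re mRe mIm pvm spi (VS _ Vy)) Vy (b := complex.Re l)).
    rewrite (pmeasure_int_cst mA (integrable_Im mRe mIm pvm spi (VS _ Vy)) Vy (b := complex.Im l)).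
      by case: l {hA VS h} => a b; apply/eqP; rewrite eq_complex /=; apply/andP; split; apply/eqP; ring.
    by move=> w /hA ->.
  by move=> w /hA ->.
move=> Vx; have Sx := VS _ Vx; split=> //.
apply/eqP; rewrite -subr_eq0; apply/eqP/dotpxx_eq0.
apply: (polarization (V := V) (h := h)) => //.
  by move=> c y z /VS Sy /VS Sz; rewrite /h (fctP linS)// scalerBr scalerDr !scalerA (mulrC l) opprD addrACA.
rewrite /V /= linfB// linfZ// Vx -(spi_commute mRe mIm pvm linS spi mA Sx).
by rewrite [E A x]Vx.
Qed.

(* [y = E B x] is again an eigenvector, and [g] has integral [0] for the measure of [y],
   which is concentrated on [B = {g > 0}]. *)
Lemma eigen_half g (l : R[i]) x : measurable_fun setT g ->
  (forall y, dom S y -> S y = l *: y ->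
    (\int[pmeasure pvm y]_w (g w)%:E = 0)%E) ->
  dom S x -> S x = l *: x -> E [set w | 0 < g w] x = 0.
Proof.
move=> mg hg Sx ex; set B := [set w | 0 < g w].
have mB : measurable B.
  have -> : B = g @^-1` `]0, +oo[%classic.
    by apply/seteqP; split => w; rewrite /B /preimage /= in_itv /= andbT.
  by rewrite -[X in measurable X]setTI; exact: mg.
set y := E B x.
have Sy : dom S y by exact: (domE mRe mIm pvm spi).
have ey : S y = l *: y.
  by rewrite /y (spi_commute mRe mIm pvm linS spi)// ex linfZ//; exact: pvm_linear pvm _ mB.
have i0 : (\int[pmeasure pvm y]_w `|(g w)%:E| = 0)%E.
  rewrite -[RHS](hg _ Sy ey); apply: ae_eq_integral => //.
  - by apply: measurableT_comp => //; exact/measurable_EFinP.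
  - exact/measurable_EFinP.
  exists (~` B); split; first exact: measurableC.
    apply/(pmeasure_eq0 pvm); first exact: measurableC.
    by apply: (pvmC0 pvm mB); exact: pvm_idem pvm _ _ mB.
  by move=> w /= hw Bw; apply: hw => _; rewrite gtr0_norm.
have mgE : measurable_fun setT (EFin \o g) by exact/measurable_EFinP.
have [N [mN N0 hN]] := (ae_eq_integral_abs (pmeasure pvm y) measurableT mgE).1 i0.
have BN : B `<=` N.
  by move=> w Bw; apply: hN => /= /(_ Logic.I) [gw]; move: Bw; rewrite /B /= gw ltxx.
have : E B y = 0.
  by apply: (pvm_sub0 pvm mB mN BN); apply/(pmeasure_eq0 pvm).
by rewrite /y (pvm_idem pvm).
Qed.

Lemma eigenvector_spi (l : R[i]) x : dom S x -> S x = l *: x ->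
  measurable [set w | f w = l] /\ E [set w | f w = l] x = x.
Proof.
move=> Sx ex.
(* The complement of [{f = l}] is covered by the four half-planes [s * (p f - p l) > 0],
   with [p] the real or imaginary part and [s = 1, -1]. *)
have key (s : R) (p : R[i] -> R) (mp : measurable_fun setT (fun w => p (f w))) :
    (forall y, dom S y -> (pmeasure pvm y).-integrable setT (EFin \o (fun w => p (f w)))) ->
    (forall y, dom S y -> S y = l *: y ->
       fine (\int[pmeasure pvm y]_w (p (f w))%:E) = p l * rn y ^+ 2) ->
    E [set w | 0 < s * (p (f w) - p l)] x = 0.
  move=> ip hp; apply: (@eigen_half (fun w => s * (p (f w) - p l)) l x) => //.
    by apply: measurable_funM => //; apply: measurable_funB.
  move=> y Sy ey.
  under eq_integral do rewrite EFinM EFinB.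
  have i1 := ip y Sy.
  have i2 : (pmeasure pvm y).-integrable setT (EFin \o cst (p l)).
    exact: finite_measure_integrable_cst.
  rewrite integralZl//; last exact: (integrableB measurableT i1 i2).
  rewrite (integralB measurableT i1 i2) -[X in (X - _)%E]fineK; last exact: integrable_fin_num i1.
  have -> : (\int[pmeasure pvm y]_w (EFin \o cst (p l)) w = (p l * rn y ^+ 2)%:E)%E.
    rewrite [LHS](integral_cst (pmeasure pvm y) measurableT (p l)%:E) /=.
    by rewrite (pmeasureT pvm)//; exact: (dom_K pvm spi Sy).
  have -> : fine (\int[pmeasure pvm y]_w (EFin \o (fun w => p (f w))) w) = p l * rn y ^+ 2.
    exact: hp.
  by rewrite subee// mule0.
have dotl y : dom S y -> S y = l *: y -> dotp (S y) y = Complex (complex.Re l * rn y ^+ 2) (complex.Im l * rn y ^+ 2).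
  move=> Sy ->; rewrite dotpZl dotpxx; case: l {key ex} => a b.
  by apply/eqP; rewrite eq_complex /=; apply/andP; split; apply/eqP; ring.
have kRe s := key s (@complex.Re R) mRe (fun y Sy => integrable_Re mRe mIm pvm spi Sy).
have kIm s := key s (@complex.Im R) mIm (fun y Sy => integrable_Im mRe mIm pvm spi Sy).
have hRe y : dom S y -> S y = l *: y ->
   fine (\int[pmeasure pvm y]_w (complex.Re (f w))%:E) = complex.Re l * rn y ^+ 2.
  by move=> Sy ey; have := dotl _ Sy ey; rewrite (dot_spi pvm spi Sy) => -[].
have hIm y : dom S y -> S y = l *: y ->
   fine (\int[pmeasure pvm y]_w (complex.Im (f w))%:E) = complex.Im l * rn y ^+ 2.
  by move=> Sy ey; have := dotl _ Sy ey; rewrite (dot_spi pvm spi Sy) => -[].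
have mpos (s : R) (p : R[i] -> R) : measurable_fun setT (fun w => p (f w)) ->
    measurable [set w | 0 < s * (p (f w) - p l)].
  move=> mp; have -> : [set w | 0 < s * (p (f w) - p l)] =
     (fun w => s * (p (f w) - p l)) @^-1` `]0, +oo[%classic.
    by apply/seteqP; split => w; rewrite /preimage /= in_itv /= andbT.
  rewrite -[X in measurable X]setTI.
  by apply: measurable_funM => //; apply: measurable_funB.
have neg (s : R) (p : R[i] -> R) : measurable_fun setT (fun w => p (f w)) ->
    E [set w | 0 < s * (p (f w) - p l)] x = 0 ->
    (pmeasure pvm x).-negligible [set w | 0 < s * (p (f w) - p l)].
  move=> mp h0; apply/negligibleP; first exact: mpos.
  by apply/(pmeasure_eq0 pvm) => //; exact: mpos.
set A := [set w | f w = l].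
have CA : ~` A = ([set w | 0 < 1 * (complex.Re (f w) - complex.Re l)] `|`
                  [set w | 0 < -1 * (complex.Re (f w) - complex.Re l)]) `|`
                 ([set w | 0 < 1 * (complex.Im (f w) - complex.Im l)] `|`
                  [set w | 0 < -1 * (complex.Im (f w) - complex.Im l)]).
  apply/seteqP; split => w; rewrite /A /=; last first.
    by move=> h fw; move: h; rewrite fw !subrr !mulr0 ltxx => -[] [].
  move=> /eqP; rewrite eq_complex negb_and !mul1r !mulN1r !opprB !subr_gt0.
  by move=> /orP[]; rewrite neq_lt => /orP[]; tauto.
have mCA : measurable (~` A) by rewrite CA; do ! apply: measurableU; exact: mpos.
have mA : measurable A by rewrite -(setCK A); exact: measurableC.
split=> //; apply: (pvm_eqC pvm mA); first exact: (dom_K pvm spi).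
apply/(pmeasure_eq0 pvm) => //; apply: (measure_negligible (mu := pmeasure pvm x)) => //.
rewrite CA.
by do ! apply: negligibleU; apply: neg => //; [exact: kRe|exact: kRe|exact: kIm|exact: kIm].
Qed.

End SpectralCalculus.

(** * Self-adjoint operators *)

Lemma sqr1_norm (R : realDomainType) (s : R) : s ^+ 2 = 1 -> `|s| = 1.
Proof. by move=> s2; apply/eqP; rewrite -(@eqrXn2 _ 2)// expr1n -normrX s2 normr1. Qed.

(** The restriction of [A t] to an eigenspace of [gamma] has its domain inside that eigenspace, so
    it is in general not [self_adjoint] as an operator on [H]; symmetry is the part that is
    inherited. *)
Definition symmetric_operator (R : realType) (H : hilbertType R) (S : operator H) :=
  forall x y, dom S x -> dom S y -> dotp (S x) y = dotp x (S y).

Section PositiveSymmetric.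
Variables (R : realType) (H : hilbertType R) (V : set H) (T : H -> H).
Hypothesis sV : subspace V.
Hypothesis TV : forall x, V x -> V (T x).
Hypothesis lT : forall c x y, V x -> V y -> T (c *: x + y) = c *: T x + T y.
Hypothesis symT : forall x y, V x -> V y -> rdot (T x) y = rdot x (T y).

(* Test positivity of [T] on [x - (1/rho) T x]. *)
Lemma psd_bound (rho : R) : 0 <= rho ->
  (forall x, V x -> 0 <= rdot (T x) x <= rho * rn x ^+ 2) ->
  forall x, V x -> rn (T x) <= rho * rn x.
Proof.
move=> rho0 h x Vx.
have key (t : R) : 0 <= rho * rn x ^+ 2 - 2 * t * rn (T x) ^+ 2 + t ^+ 2 * rho * rn (T x) ^+ 2.
  have VTx := TV Vx.
  have Vz : V ((- t)%:C *: T x + x) by exact: sV.2.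
  have /andP[+ _] := h _ Vz; rewrite lT//.
  rewrite !(rdotDl, rdotDr, rdotZl, rdotZr) (symT VTx Vx) rdotxx.
  have /andP[_ h1] := h _ Vx; have /andP[_ h2] := h _ VTx.
  have h3 : t ^+ 2 * rdot (T (T x)) (T x) <= t ^+ 2 * (rho * rn (T x) ^+ 2).
    by rewrite ler_wpM2l ?sqr_ge0.
  nra.
rewrite -ler_sqr ?nnegrE ?rn_ge0//; last by rewrite mulr_ge0 ?rn_ge0.
have [r0|r0] := eqVneq rho 0.
  by have := key 1; rewrite r0 !mul0r; nra.
have rp : 0 < rho by rewrite lt_neqAle eq_sym r0.
have := key rho^-1; rewrite exprMn.
have -> : rho * rn x ^+ 2 - 2 * rho^-1 * rn (T x) ^+ 2 + rho^-1 ^+ 2 * rho * rn (T x) ^+ 2 =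
   rho^-1 * (rho ^+ 2 * rn x ^+ 2 - rn (T x) ^+ 2) by field.
by rewrite pmulr_rge0 ?invr_gt0// subr_ge0.
Qed.

End PositiveSymmetric.

Section SelfAdjoint.
Variables (R : realType) (H : hilbertType R) (K : set H) (E : set R -> H -> H)
  (S : operator H).
Hypothesis sm : sa_spectral_measure K S E.
Hypothesis linS : linear_operator S.
Hypothesis symS : symmetric_operator S.
Implicit Types (x y z : H) (A B : set R) (s m : R).

Let pvm : projection_valued_measure K E. Proof. by case: sm. Qed.
Let spi : is_spectral_integral (fun r : R => r%:C) K E S. Proof. by case: sm. Qed.
Let mRe : measurable_fun setT (fun r : R => complex.Re (r%:C)).
Proof. exact: measurable_id. Qed.
Let mIm : measurable_fun setT (fun r : R => complex.Im (r%:C)).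
Proof. exact: measurable_cst. Qed.

Lemma sa_domE A x : measurable A -> dom S x -> dom S (E A x).
Proof. exact: (domE mRe mIm pvm spi). Qed.

Lemma sa_commute A x : measurable A -> dom S x -> S (E A x) = E A (S x).
Proof. exact: (spi_commute mRe mIm pvm linS spi). Qed.

Lemma sa_bounded_dom (M : R) A x : measurable A -> (forall w, A w -> `|w| <= M) ->
  E A x = x -> dom S x.
Proof.
move=> mA hA; apply: (bounded_dom mRe mIm pvm spi (M := M ^+ 2)) => // w Aw /=.
by rewrite expr0n addr0 -(real_normK (num_real w)) lerXn2r ?nnegrE// ?(le_trans _ (hA _ Aw)) ?hA.
Qed.

Lemma sa_shift_dom s m (rho : R) A x : s ^+ 2 = 1 -> measurable A ->
  (forall w, A w -> 0 <= s * (w - m) <= rho) -> E A x = x -> dom S x.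
Proof.
move=> s2 mA hA; apply: (sa_bounded_dom (M := rho + `|m|)) => // w /hA /andP[h1 h2].
have -> : w = s * (s * (w - m)) + m by rewrite mulrA -expr2 s2 mul1r subrK.
rewrite (le_trans (ler_normD _ _))// lerD2r normrM sqr1_norm//.
by rewrite mul1r ger0_norm.
Qed.

Lemma eigenvector_sa (l : R) x : dom S x -> S x = l%:C *: x -> E [set l] x = x.
Proof.
move=> Sx ex; have [_] := eigenvector_spi mRe mIm pvm linS spi Sx ex.
by have -> : [set w : R | w%:C = l%:C] = [set l] by apply/seteqP; split => [w /= []|w /= ->].
Qed.

Lemma rdot_sym x y : dom S x -> dom S y -> rdot (S x) y = rdot x (S y).
Proof. by move=> Sx Sy; rewrite /rdot symS. Qed.

(** With [s = 1] the spectrum is measured upwards from [m], with [s = -1] downwards; the hypothesis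
    [s ^+ 2 = 1] treats both cases at once. *)
Definition shift s m x : H := s%:C *: (S x - m%:C *: x).

Lemma rdot_shift s m x : rdot (shift s m x) x = s * (rdot (S x) x - m * rn x ^+ 2).
Proof. by rewrite /shift rdotZl rdotDl rdotNl rdotZl rdotxx. Qed.

Lemma shiftP s m c x y : dom S x -> dom S y ->
  shift s m (c *: x + y) = c *: shift s m x + shift s m y.
Proof.
move=> Sx Sy; rewrite /shift (fctP linS)// scalerA (mulrC c) -scalerA -scalerDr.
congr (_ *: _); rewrite scalerBr scalerDr !scalerA (mulrC c) opprD.
by rewrite !addrA; congr (_ - _); rewrite -!addrA; congr (_ + _); rewrite addrC.
Qed.

Lemma shiftE s m A x : measurable A -> dom S x -> E A (shift s m x) = shift s m (E A x).
Proof.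
move=> mA Sx; have lE := pvm_linear pvm mA.
by rewrite /shift linfZ// linfB// linfZ// sa_commute.
Qed.

Lemma rdot_shift_ge s m (sigma : R) A x : s ^+ 2 = 1 -> measurable A ->
  (forall w, A w -> sigma <= s * (w - m)) -> dom S x -> E A x = x ->
  sigma * rn x ^+ 2 <= rdot (shift s m x) x.
Proof.
move=> s2 mA hA Sx EA; rewrite rdot_shift.
have /orP[/eqP s1|/eqP s1] : (s == 1) || (s == -1) by rewrite -sqrf_eq1 s2.
- have := spi_ge mRe mIm pvm spi (b := sigma + m) mA Sx EA.
  rewrite s1 mul1r mulrDl lerBrDr; apply => w /hA /=; rewrite s1; lra.
- have := spi_le mRe mIm pvm spi (b := m - sigma) mA Sx EA.
  rewrite s1 => h.
  have {}h : rdot (S x) x <= (m - sigma) * rn x ^+ 2.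
    by apply: h => w /hA /=; rewrite s1; lra.
  by move: h; rewrite mulrBl; lra.
Qed.

Lemma rdot_shift_le s m (rho : R) A x : s ^+ 2 = 1 -> measurable A ->
  (forall w, A w -> s * (w - m) <= rho) -> dom S x -> E A x = x ->
  rdot (shift s m x) x <= rho * rn x ^+ 2.
Proof.
move=> s2 mA hA Sx EA.
have hN w : A w -> - rho <= - s * (w - m) by move=> /hA; lra.
have := rdot_shift_ge (s := - s) (sigma := - rho) _ mA hN Sx EA.
by rewrite sqrrN !rdot_shift => /(_ s2); lra.
Qed.

Lemma rn_shift_ge s m (sigma : R) A x : s ^+ 2 = 1 -> measurable A ->
  (forall w, A w -> sigma <= s * (w - m)) -> dom S x -> E A x = x ->
  sigma * rn x <= rn (shift s m x).
Proof.
move=> s2 mA hA Sx EA; have h := rdot_shift_ge s2 mA hA Sx EA.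
have [->|x0] := eqVneq x 0; first by rewrite rn0 mulr0 rn_ge0.
rewrite -(ler_pM2r (rn_gt0 x0)) -mulrA -expr2 (le_trans h)//.
exact: rdot_le.
Qed.

(** The bound on the form becomes a bound on the norm because [shift s m] is positive on the range
    of [E A], which is invariant and contained in [dom S]. *)
Lemma rn_shift_le s m (rho : R) A x : s ^+ 2 = 1 -> 0 <= rho -> measurable A ->
  (forall w, A w -> 0 <= s * (w - m) <= rho) -> E A x = x ->
  rn (shift s m x) <= rho * rn x.
Proof.
move=> s2 rho0 mA hA EA.
have domV y : E A y = y -> dom S y := sa_shift_dom s2 mA hA.
apply: (psd_bound (V := [set y | E A y = y]) (T := shift s m)) => //.
- split => [|c y z /= Vy Vz]; first by rewrite /= linf0//; exact: pvm_linear pvm _ mA.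
  by rewrite (pvm_linear pvm mA) Vy Vz.
- by move=> y /= Vy; rewrite shiftE ?Vy//; exact: domV.
- by move=> c y z /= /domV Sy /domV Sz; exact: shiftP.
- move=> y z /= /domV Sy /domV Sz; rewrite /shift !(rdotZl, rdotZr, rdotDl, rdotDr, rdotNl, rdotNr).
  by rewrite rdot_sym.
- move=> y /= Vy; rewrite (rdot_shift_le s2 mA _ (domV _ Vy) Vy) ?andbT; last by move=> w /hA/andP[].
  have := rdot_shift_ge (sigma := 0) s2 mA _ (domV _ Vy) Vy; rewrite mul0r; apply.
  by move=> w /hA/andP[].
Qed.

End SelfAdjoint.

(** * Operators intertwining two self-adjoint operators *)

Section Intertwining.
Variables (R : realType) (H : hilbertType R).
Variables (K : set H) (E : set R -> H -> H) (S : operator H).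
Variables (K' : set H) (E' : set R -> H -> H) (S' : operator H).
Hypothesis sm : sa_spectral_measure K S E.
Hypothesis linS : linear_operator S.
Hypothesis symS : symmetric_operator S.
Hypothesis sm' : sa_spectral_measure K' S' E'.
Hypothesis linS' : linear_operator S'.
Hypothesis symS' : symmetric_operator S'.
Variables (U : H -> H) (C : R).
Hypothesis linU : linear U.
Hypothesis bU : forall x, rn (U x) <= C * rn x.
Hypothesis UK : forall x, K x -> K' (U x).
Hypothesis US : forall x, dom S x -> dom S' (U x) /\ S' (U x) = U (S x).

Let pvm : projection_valued_measure K E. Proof. by case: sm. Qed.
Let pvm' : projection_valued_measure K' E'. Proof. by case: sm'. Qed.

Lemma intertwining_separated (s m rho sigma : R) (A B : set R) x : s ^+ 2 = 1 ->
  0 <= rho -> rho < sigma -> measurable A -> measurable B ->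
  (forall w, A w -> 0 <= s * (w - m) <= rho) ->
  (forall w, B w -> sigma <= s * (w - m)) ->
  E A x = x -> E' B (U x) = 0.
Proof.
move=> s2 rho0 rs mA mB hA hB EA.
have s0 : 0 < sigma by exact: le_lt_trans rs.
have domV y : E A y = y -> dom S y := sa_shift_dom sm s2 mA hA.
have key n : forall y, E A y = y -> sigma ^+ n * rn (E' B (U y)) <= C * (rho ^+ n * rn y).
  elim: n => [|n IHn] y Vy.
    rewrite !expr0 !mul1r (le_trans (oproj_le (pvm_oproj pvm' mB) _))//.
  have Sy := domV _ Vy; have [S'y e] := US Sy.
  have lE' := pvm_linear pvm' mB.
  have step : sigma * rn (E' B (U y)) <= rn (E' B (U (shift S s m y))).
    have -> : E' B (U (shift S s m y)) = shift S' s m (E' B (U y)).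
      rewrite -(shiftE sm' linS')//; congr (E' B _).
      by rewrite /shift linfZ// linfB// linfZ// e.
    apply: (rn_shift_ge sm' s2 mB hB); first exact: (sa_domE sm' mB).
    exact: pvm_idem pvm' _ _ mB.
  have VTy : E A (shift S s m y) = shift S s m y by rewrite (shiftE sm linS)// Vy.
  have Ty := rn_shift_le sm linS symS s2 rho0 mA hA Vy.
  have sn0 : 0 <= sigma ^+ n by rewrite exprn_ge0 ?ltW.
  have rn0' : 0 <= rho ^+ n by rewrite exprn_ge0.
  have h1 : sigma ^+ n.+1 * rn (E' B (U y)) <= sigma ^+ n * rn (E' B (U (shift S s m y))).
    by rewrite exprSr -mulrA ler_wpM2l.
  apply: (le_trans h1); apply: (le_trans (IHn _ VTy)).
  have C0 : 0 <= C * rn y by rewrite (le_trans _ (bU _))// rn_ge0.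
  (* No sign is assumed on [C]; a nonzero vector makes the bound on [U] yield [0 <= C]. *)
  have [->|y0] := eqVneq (shift S s m y) 0.
    rewrite rn0 !mulr0 mulrCA mulr_ge0// ?exprn_ge0//.
  have C0' : 0 <= C.
    by rewrite -(pmulr_lge0 _ (rn_gt0 y0)) (le_trans _ (bU _))// rn_ge0.
  by rewrite ler_wpM2l// exprSr -mulrA ler_wpM2l.
apply: rn_eq0; apply/eqP; rewrite eq_le rn_ge0 andbT.
set a := rn _; set b := C * rn x.
have q0 : 0 <= rho / sigma by rewrite divr_ge0// ltW.
have q1 : `|rho / sigma| < 1 by rewrite ger0_norm// ltr_pdivrMr// mul1r.
have hq n : a <= b * (rho / sigma) ^+ n.
  rewrite expr_div_n mulrA ler_pdivlMr ?exprn_gt0// mulrC (le_trans (key n _ EA))//.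
  by rewrite /b -mulrA (mulrC (rn x)).
have cv : (fun n => b * (rho / sigma) ^+ n) @ \oo --> b * 0.
  by apply: cvgMr; exact: cvg_expr.
rewrite mulr0 in cv.
by apply: (ler_cvg_to (cvg_cst a) cv); exact: nearW.
Qed.

Let phi_lin B : measurable B -> linear (fun y => E' B (U y)).
Proof. by move=> mB c x y /=; rewrite linU (pvm_linear pvm' mB). Qed.

Let phi_bound B : measurable B -> forall y, rn (E' B (U y)) <= C * rn y.
Proof. by move=> mB y; rewrite (le_trans (oproj_le (pvm_oproj pvm' mB) _)). Qed.

(** [intertwining_separated] wants a bounded source set and a gap before the target set. For the
    source inside the open ray the gap comes from exhausting the ray by compact intervals; the
    complementary source touches [c], so there the target ray is exhausted too. *)
Lemma intertwining_ray (c : R) x : K x -> U (E `]-oo, c[%classic x) = E' `]-oo, c[%classic (U x).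
Proof.
move=> Kx; set I := (X in E X x); have mI : measurable I by exact: measurable_itv.
have mCI : measurable (~` I) by exact: measurableC.
have h1 : E' (~` I) (U (E I x)) = 0.
  pose F n := `[c - n.+1%:R, c - n.+1%:R^-1]%classic.
  have mF n : measurable (F n) by exact: measurable_itv.
  have FU : \bigcup_n F n = I.
    apply/seteqP; split => w.
      move=> [n _]; rewrite /F /I /= !in_itv /= => /andP[_ h].
      rewrite (le_lt_trans h)// ltrBlDr ltrDl invr_gt0//.
    rewrite /I /= in_itv /= => wc.
    pose k := maxn (Num.truncn (c - w)) (Num.truncn (c - w)^-1).
    have cw : 0 < c - w by rewrite subr_gt0.
    exists k => //; rewrite /F /= in_itv /=; apply/andP; split.
      rewrite lerBlDr -lerBlDl ltW// (lt_le_trans (truncnS_gt _))//.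
      by rewrite ler_nat ltnS leq_maxl.
    rewrite lerBrDr -lerBrDl -[leRHS]invrK lef_pV2 ?posrE ?invr_gt0//.
    by rewrite ltW// (lt_le_trans (truncnS_gt _))// ler_nat ltnS leq_maxr.
  rewrite -{2}FU.
  apply: (pvm_bigcup0 pvm (phi := fun y => E' (~` I) (U y)) (phi_lin mCI) (phi_bound mCI) mF).
  move=> n A mA AF.
  have p : 0 < (n.+1%:R : R) by [].
  have q : 0 < (n.+1%:R : R)^-1 by rewrite invr_gt0.
  have q1 : (n.+1%:R : R)^-1 <= n.+1%:R by rewrite (@le_trans _ _ 1)// ?invf_le1 ?ler1n.
  (* Distances run upwards from the left end of [F n]: the complement of the ray starts at distance
     [n.+1], beyond the length [n.+1 - n.+1^-1] of [F n]. *)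
  apply: (@intertwining_separated 1 (c - n.+1%:R) (n.+1%:R - n.+1%:R^-1) n.+1%:R A) => //.
  - by rewrite expr1n.
  - by rewrite subr_ge0.
  - by rewrite ltrBlDr ltrDl.
  - move=> w /AF; rewrite /F /= in_itv /=; move: (n.+1%:R^-1 : R) (n.+1%:R : R) => a b.
    by move=> /andP[h1' h2']; apply/andP; split; lra.
  - by move=> w; rewrite /I /= in_itv /= => /negP; rewrite -leNgt; lra.
  - exact: pvm_idem pvm _ _ mA.
have h2 : E' I (U (E (~` I) x)) = 0.
  pose F n := `[c, c + n.+1%:R]%classic.
  pose G n := `]-oo, c - n.+1%:R^-1]%classic.
  have mF n : measurable (F n) by exact: measurable_itv.
  have mG n : measurable (G n) by exact: measurable_itv.
  have FU : \bigcup_n F n = ~` I.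
    apply/seteqP; split => w.
      move=> [n _]; rewrite /F /I /= !in_itv /= => /andP[h _].
      by apply/negP; rewrite -leNgt.
    rewrite /I /= in_itv /= => /negP; rewrite -leNgt => wc.
    exists (Num.truncn (w - c)) => //; rewrite /F /= in_itv /= wc /=.
    by rewrite -lerBlDl ltW// truncnS_gt.
  have GU : \bigcup_n G n = I.
    apply/seteqP; split => w.
      move=> [n _]; rewrite /G /I /= !in_itv /= => h.
      rewrite (le_lt_trans h)// ltrBlDr ltrDl invr_gt0//.
    rewrite /I /= in_itv /= => wc.
    have cw : 0 < c - w by rewrite subr_gt0.
    exists (Num.truncn (c - w)^-1) => //; rewrite /G /= in_itv /=.
    rewrite lerBrDr -lerBrDl -[leRHS]invrK lef_pV2 ?posrE ?invr_gt0//.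
    by rewrite ltW// truncnS_gt.
  rewrite -FU.
  apply: (pvm_bigcup0 pvm (phi := fun y => E' I (U y)) (phi_lin mI) (phi_bound mI) mF).
  move=> n A mA AF; rewrite -GU; apply: (pvm_bigcup0_id pvm' mG) => k.
  have q : 0 < (k.+1%:R : R)^-1 by rewrite invr_gt0.
  (* Distances run downwards from the right end of [F n], which has length [n.+1]; [G k] starts
     [k.+1^-1] further away. *)
  apply: (@intertwining_separated (-1) (c + n.+1%:R) n.+1%:R (n.+1%:R + k.+1%:R^-1) A) => //.
  - by rewrite sqrrN expr1n.
  - by rewrite ltrDl.
  - by move=> w /AF; rewrite /F /= in_itv /= => /andP[h1' h2']; apply/andP; split; lra.
  - by move=> w; rewrite /G /= in_itv /=; move: (k.+1%:R^-1 : R) => a; lra.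
  - exact: pvm_idem pvm _ _ mA.
have e1 : E' I (U (E I x)) = U (E I x).
  by apply: (pvm_eqC pvm' mI) => //; apply: UK; exact: pvmK pvm _ _ mI.
rewrite -[in RHS](pvmC pvm mI Kx) linfD// linfD ?h2 ?addr0 ?e1//.
exact: pvm_linear pvm' _ mI.
Qed.

(** The sets satisfying the relation form a Dynkin system containing the open rays, which are stable
    under intersection and generate the Borel sets. It is used with [U = gamma] for commutation and
    with [U = id] for uniqueness. *)
Theorem intertwining A x : measurable A -> K x -> U (E A x) = E' A (U x).
Proof.
move=> mA; move: x.
apply: (dynkin_induction (G := @RGenInftyO.G R)
   (P := fun A => forall x, K x -> U (E A x) = E' A (U x))) => //.
- exact: RGenInftyO.measurableE.
- move=> _ _ [a ->] [b ->]; exists (Num.min a b); apply/seteqP; split => w /=;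
    by rewrite !in_itv /= lt_min => /andP.
- by move=> x Kx; rewrite ((pvmT pvm x).1 Kx) ((pvmT pvm' _).1 (UK Kx)).
- by move=> _ [c ->] x Kx; exact: intertwining_ray.
- move=> B mB h x Kx; have hx := h _ Kx.
  have := congr1 U (pvmC pvm mB Kx); rewrite -[in RHS](pvmC pvm' mB (UK Kx)) linfD// hx.
  exact: addrI.
- move=> F mF tF h x Kx.
  apply: cvgH_unique (cvgH_linear linU bU (pvm_sigma pvm (x := x) mF tF)) _.
  have -> : U \o (fun n => \sum_(k < n) E (F k) x) = (fun n => \sum_(k < n) E' (F k) (U x)).
    by apply/funext => n /=; rewrite linf_sum//; apply: eq_bigr => k _; exact: h.
  exact: pvm_sigma pvm' _ _ mF tF.
- have : (@ocitv R).-sigma.-measurable A by exact: mA.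
  by rewrite RGenInftyO.measurableE.
Qed.

End Intertwining.

(** * Finite-dimensional subspaces *)

Section Bases.
Variables (R : realType) (H : hilbertType R).
Implicit Types (V W : set H) (x y : H).

Definition free_family n (e : 'I_n -> H) : Prop :=
  forall c : 'I_n -> R[i], \sum_i c i *: e i = 0 -> forall i, c i = 0.

(** A coefficient matrix with more rows than columns has a nonzero row vector in its left kernel,
    and this row is a linear relation among the [e i]. *)
Lemma free_family_le n m (e : 'I_n -> H) (f : 'I_m -> H) : free_family e ->
  (forall i, exists c : 'I_m -> R[i], e i = \sum_j c j *: f j) -> (n <= m)%N.
Proof.
move=> fe /choice[M eM]; rewrite leqNgt; apply/negP => mn.
pose A : 'M[R[i]]_(n, m) := \matrix_(i, j) M i j.
have : kermx A != 0.
  by rewrite kermx_eq0 /row_free neq_ltn (leq_ltn_trans (rank_leq_col A) mn).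
rewrite -nz_row_eq0 => /negP; apply; apply/eqP; set v := nz_row _.
have vA : v *m A = 0 by apply/sub_kermxP; exact: nz_row_sub.
apply/rowP => i; rewrite [RHS]mxE; apply: (fe (fun i => v 0 i)).
under eq_bigr do rewrite eM scaler_sumr.
rewrite exchange_big big1// => j _.
under eq_bigr do rewrite scalerA.
rewrite -scaler_suml -[X in X *: _](_ : (v *m A) 0 j = _).
  by rewrite vA mxE scale0r.
by rewrite mxE; apply: eq_bigr => k _; rewrite mxE.
Qed.

Lemma is_basis_free V n (e : 'I_n -> H) : is_basis V e -> free_family e.
Proof. by case. Qed.

Lemma is_basis_mem V n (e : 'I_n -> H) i : is_basis V e -> V (e i).
Proof.
case=> _ h; apply/h; exists (fun j => (j == i)%:R).
rewrite (bigD1 i)//= eqxx scale1r big1 ?addr0// => j /negbTE ->.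
by rewrite scale0r.
Qed.

Lemma is_basis_subspace V n (e : 'I_n -> H) : is_basis V e -> subspace V.
Proof.
case=> _ h; split.
  by apply/h; exists (fun=> 0); rewrite big1// => i _; rewrite scale0r.
move=> c x y /h[a ->] /h[b ->]; apply/h; exists (fun i => c * a i + b i).
rewrite scaler_sumr -big_split; apply: eq_bigr => i _ /=.
by rewrite scalerDl scalerA.
Qed.

Lemma is_basis_le V W n m (e : 'I_n -> H) (f : 'I_m -> H) :
  is_basis V e -> is_basis W f -> V `<=` W -> (n <= m)%N.
Proof.
move=> be bf VW; apply: (free_family_le (f := f) (is_basis_free be)) => i.
by apply/bf.2/VW; exact: is_basis_mem be.
Qed.

Lemma is_basis_size V n m (e : 'I_n -> H) (f : 'I_m -> H) :
  is_basis V e -> is_basis V f -> n = m.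
Proof.
by move=> be bf; apply/eqP; rewrite eqn_leq (is_basis_le be bf)// (is_basis_le bf be).
Qed.

Lemma dim_basis V n (e : 'I_n -> H) : is_basis V e -> dim V = n.
Proof.
move=> be; rewrite /dim; case: xgetP => [k _ [f bf]|/(_ n)[]]; last by exists e.
exact: is_basis_size bf be.
Qed.

Lemma dimP V : finite_dim V -> exists e : 'I_(dim V) -> H, is_basis V e.
Proof. by move=> [n [e be]]; rewrite (dim_basis be); exists e. Qed.

Definition cons_family n (x : H) (e : 'I_n -> H) (i : 'I_n.+1) : H :=
  if unlift ord0 i is Some j then e j else x.

Lemma sum_cons_family n (x : H) (e : 'I_n -> H) (c : 'I_n.+1 -> R[i]) :
  \sum_i c i *: cons_family x e i = c ord0 *: x + \sum_i c (lift ord0 i) *: e i.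
Proof.
rewrite big_ord_recl /cons_family unlift_none; congr (_ + _).
by apply: eq_bigr => i _; rewrite liftK.
Qed.

Lemma free_cons n x (e : 'I_n -> H) : free_family e ->
  (forall c : 'I_n -> R[i], x != \sum_i c i *: e i) -> free_family (cons_family x e).
Proof.
move=> fe hx c; rewrite sum_cons_family => h.
have c0 : c ord0 = 0.
  apply/eqP/negPn/negP => c0.
  move: (hx (fun i => - (c ord0)^-1 * c (lift ord0 i))) => /negP; apply; apply/eqP.
  under eq_bigr do rewrite -scalerA.
  rewrite -scaler_sumr; move/eqP: h; rewrite addrC addr_eq0 => /eqP ->.
  by rewrite scalerN scaleNr opprK scalerA mulVf// scale1r.
move: h; rewrite c0 scale0r add0r => /fe h i.
by case: (unliftP ord0 i) => [j ->|->].
Qed.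

(** A free family in [W] of maximal size spans [W], since any vector outside its span would extend
    it; sizes are bounded by the dimension of [V]. *)
Lemma finite_dim_sub V W : finite_dim V -> subspace W -> W `<=` V -> finite_dim W.
Proof.
move=> [n [f bf]] sW WV.
pose P k := `[< exists e : 'I_k -> H, free_family e /\ forall i, W (e i) >].
have P0 : exists k, P k.
  by exists 0%N; apply/asboolP; exists (fun i => 0); split => [c _|] [].
have Pn k : P k -> (k <= n)%N.
  move=> /asboolP[e [fe We]]; apply: (free_family_le (f := f) fe) => i.
  by apply/bf.2/WV.
case: (ex_maxnP P0 Pn) => k /asboolP[e [fe We]] kmax.
exists k, e; split => // x; split => [Wx|[c ->]]; last first.
  by apply: (subspace_sum sW) => i; exact: subspaceZ.
apply: contrapT => hx.
have : (k.+1 <= k)%N; last by rewrite ltnn.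
apply: kmax; apply/asboolP; exists (cons_family x e); split.
  by apply: free_cons => // c; apply/eqP => xe; apply: hx; exists c.
by move=> i; rewrite /cons_family; case: unlift.
Qed.

Lemma dim_inj V W (phi : H -> H) : finite_dim V -> finite_dim W -> linear phi ->
  (forall x, V x -> W (phi x)) -> (forall x, V x -> phi x = 0 -> x = 0) ->
  (dim V <= dim W)%N.
Proof.
move=> /dimP[e be] /dimP[f bf] lphi pVW inj.
apply: (@free_family_le _ _ (phi \o e) f); last first.
  by move=> i /=; apply/bf.2/pVW; exact: is_basis_mem be.
move=> c h; apply: (is_basis_free be); apply: inj.
  by apply/be.2; exists c.
rewrite linf_sum// -[RHS]h; apply: eq_bigr => i _.
by rewrite linfZ.
Qed.

Definition cat_family n m (e : 'I_n -> H) (f : 'I_m -> H) (i : 'I_(n + m)) : H :=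
  match fintype.split i with inl j => e j | inr k => f k end.

Lemma sum_cat_family n m (e : 'I_n -> H) (f : 'I_m -> H) (c : 'I_(n + m) -> R[i]) :
  \sum_i c i *: cat_family e f i =
  \sum_i c (lshift m i) *: e i + \sum_i c (rshift n i) *: f i.
Proof.
rewrite big_split_ord /cat_family; congr (_ + _); apply: eq_bigr => i _.
  by rewrite (unsplitK (inl i)).
by rewrite (unsplitK (inr i)).
Qed.

Lemma is_basis_cat V W X n m (e : 'I_n -> H) (f : 'I_m -> H) :
  is_basis V e -> is_basis W f ->
  (forall x, X x <-> exists v w, [/\ V v, W w & x = v + w]) ->
  (forall v, V v -> W v -> v = 0) ->
  is_basis X (cat_family e f).
Proof.
move=> be bf hX VW0; split.
  move=> c; rewrite sum_cat_family => h.
  set a := (X in X + _) in h; set b := (X in _ + X) in h.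
  have Va : V a by apply/be.2; exists (fun i => c (lshift m i)).
  have Wb : W b by apply/bf.2; exists (fun i => c (rshift n i)).
  have ab : a = - b by move/eqP: h; rewrite addr_eq0 => /eqP.
  have a0 : a = 0.
    by apply: VW0 => //; rewrite ab; apply: subspaceN => //; exact: is_basis_subspace bf.
  have b0 : b = 0 by move: h; rewrite a0 add0r.
  move=> i; rewrite -(splitK i); case: (fintype.split i) => j /=.
    exact: (is_basis_free be a0 j).
  exact: (is_basis_free bf b0 j).
move=> x; split.
  move=> /hX[v [w [/be.2[c ->] /bf.2[c' ->] ->]]].
  exists (fun i => match fintype.split i with inl j => c j | inr k => c' k end).
  rewrite sum_cat_family; congr (_ + _); apply: eq_bigr => i _.
    by rewrite (unsplitK (inl i)).
  by rewrite (unsplitK (inr i)).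
move=> [c ->]; rewrite sum_cat_family; apply/hX.
exists (\sum_i c (lshift m i) *: e i), (\sum_i c (rshift n i) *: f i); split => //.
  by apply/be.2; exists (fun i => c (lshift m i)).
by apply/bf.2; exists (fun i => c (rshift n i)).
Qed.

Lemma dim_add V W X : finite_dim V -> finite_dim W ->
  (forall x, X x <-> exists v w, [/\ V v, W w & x = v + w]) ->
  (forall v, V v -> W v -> v = 0) ->
  finite_dim X /\ dim X = (dim V + dim W)%N.
Proof.
move=> /dimP[e be] /dimP[f bf] hX VW0.
have bX := is_basis_cat be bf hX VW0; split; last exact: dim_basis bX.
by exists (dim V + dim W)%N, (cat_family e f).
Qed.

Lemma eigenvector_exists V n (e : 'I_n.+1 -> H) (T : H -> H) : is_basis V e ->
  (forall x, V x -> V (T x)) ->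
  (forall c x y, V x -> V y -> T (c *: x + y) = c *: T x + T y) ->
  exists (l : R[i]) x, [/\ V x, x != 0 & T x = l *: x].
Proof.
move=> be TV lT; have sV := is_basis_subspace be.
have /choice[M eM] j : exists c : 'I_n.+1 -> R[i], T (e j) = \sum_i c i *: e i.
  by apply/be.2/TV; exact: is_basis_mem be.
(* Row [j] holds the coordinates of [T (e j)], so the row eigenvectors provided by [eigenvalueP] are
   coordinate rows of eigenvectors of [T]. *)
pose A : 'M[R[i]]_n.+1 := \matrix_(j, i) M j i.
have /closed_rootP[l rl] : size (char_poly A) != 1%N by rewrite size_char_poly.
have /eigenvalueP[v vA v0] : eigenvalue A l by rewrite eigenvalue_root_char.
exists l, (\sum_i v 0 i *: e i); split.
- by apply/be.2; exists (fun i => v 0 i).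
- apply: contra_neq v0 => h; apply/rowP => i; rewrite [RHS]mxE.
  exact: (is_basis_free be h).
have Tsum (c : 'I_n.+1 -> R[i]) : T (\sum_i c i *: e i) = \sum_i c i *: T (e i).
  have T0 : T 0 = 0.
    have := lT 1 0 0 sV.1 sV.1; rewrite !scale1r addr0 => /eqP.
    by rewrite -{1}(addr0 (T 0)) (inj_eq (addrI _)) eq_sym => /eqP.
  elim: (index_enum _) => [|i r IHr]; first by rewrite !big_nil.
  rewrite !big_cons lT ?IHr//; first exact: is_basis_mem be.
  by elim/big_ind : _ => [||j _]; [exact: sV.1|exact: subspaceD|apply: subspaceZ => //; exact: is_basis_mem be].
rewrite Tsum.
under eq_bigr do rewrite eM scaler_sumr.
rewrite exchange_big scaler_sumr; apply: eq_bigr => j _ /=.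
under eq_bigr do rewrite scalerA.
rewrite -scaler_suml scalerA; congr (_ *: _).
have := congr1 (fun u : 'rV_n.+1 => u 0 j) vA; rewrite !mxE => <-.
by apply: eq_bigr => i _; rewrite mxE.
Qed.

(* Orthogonal complements of eigenvectors are invariant for unitary as well as for
   symmetric operators. *)
Lemma eigenbasis V (T : H -> H) : finite_dim V ->
  (forall x, V x -> V (T x)) ->
  (forall c x y, V x -> V y -> T (c *: x + y) = c *: T x + T y) ->
  (forall l x y, V x -> V y -> x != 0 -> T x = l *: x -> dotp y x = 0 -> dotp (T y) x = 0) ->
  exists n (e : 'I_n -> H) (l : 'I_n -> R[i]),
    is_basis V e /\ forall i, T (e i) = l i *: e i.
Proof.
move=> [n [e be]]; elim: n V e be => [|n IHn] V e be TV lT oT.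
  by exists 0%N, e, (fun=> 0); split => // -[].
have sV := is_basis_subspace be.
have [l [x [Vx x0 Tx]]] := eigenvector_exists be TV lT.
pose W := [set y | V y /\ dotp y x = 0].
have sW : subspace W.
  split => [|c y z [Vy y0] [Vz z0]]; first by split; [exact: sV.1|exact: dotp0l].
  by split; [exact: sV.2|rewrite dotpDl dotpZl y0 z0 mulr0 addr0].
have fW : finite_dim W.
  by apply: (finite_dim_sub (V := V)) => // [|y []]//; exists n.+1, e.
pose L := [set y : H | exists c : R[i], y = c *: x].
have bL : is_basis L (fun _ : 'I_1 => x).
  split => [c|y]; last first.
    split => [[c ->]|[c]]; first by exists (fun=> c); rewrite big_ord1.
    by rewrite big_ord1 => ->; exists (c ord0).
  rewrite big_ord1 => /eqP; rewrite scaler_eq0 (negbTE x0) orbF => /eqP h i.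
  by rewrite (ord1 i).
have xx0 : dotp x x != 0 by apply: contra_neq x0; exact: dotpxx_eq0.
have hV y : V y <-> exists v w, [/\ L v, W w & y = v + w].
  split; last first.
    by move=> [_ [w [[c ->] [Vw _] ->]]]; exact: sV.2.
  move=> Vy; set c := dotp y x / dotp x x.
  exists (c *: x), (y - c *: x); split; first by exists c.
    split; first by apply: (subspaceB sV) => //; exact: subspaceZ.
    by rewrite dotpDl dotpNl dotpZl /c divfK// subrr.
  by rewrite addrC subrK.
have LW0 v : L v -> W v -> v = 0.
  move=> [c ->] [_]; rewrite dotpZl => /eqP.
  by rewrite mulf_eq0 (negbTE xx0) orbF => /eqP ->; rewrite scale0r.
have [f bf] := dimP fW.
have dW : dim W = n.
  by have := is_basis_size (is_basis_cat bL bf hV LW0) be; rewrite add1n => -[].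
rewrite dW in f bf.
have [m [f' [l' [bf' Tf']]]] : exists m (e : 'I_m -> H) (l : 'I_m -> R[i]),
    is_basis W e /\ forall i, T (e i) = l i *: e i.
  apply: (IHn _ f bf).
  - move=> y [Vy y0]; split; first exact: TV.
    exact: (oT l x y).
  - by move=> c y z [Vy _] [Vz _]; exact: lT.
  - by move=> k y z [Vy _] [Vz _]; exact: oT.
exists (1 + m)%N, (cat_family (fun _ : 'I_1 => x) f').
exists (fun i => match fintype.split i with inl _ => l | inr k => l' k end); split.
  exact: is_basis_cat bL bf' hV LW0.
by move=> i; rewrite /cat_family; case: (fintype.split i).
Qed.

(** The basis picked by [xget] is arbitrary; its matrix is conjugate to [M] through the change of
    basis [mC], with inverse [mD], and the trace is invariant under conjugation. *)
Lemma trace_onE V n (e : 'I_n -> H) (M : 'M[R[i]]_n) (T : H -> H) : linear T ->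
  is_basis V e -> (forall j, T (e j) = \sum_i M i j *: e i) ->
  trace_on T V = \tr M.
Proof.
move=> lT be eM; rewrite /trace_on; case: xgetP => [c _|/(_ (\tr M))[]]; last first.
  by exists n, e, M.
move=> [n' [e' [M' [be' eM' ->]]]].
have nn := is_basis_size be' be; move: e' M' be' eM'; rewrite nn => e' M' be' eM'.
have /choice[C eC] j : exists c : 'I_n -> R[i], e' j = \sum_i c i *: e i.
  by apply/be.2; exact: is_basis_mem be'.
have /choice[D eD] j : exists c : 'I_n -> R[i], e j = \sum_i c i *: e' i.
  by apply/be'.2; exact: is_basis_mem be.
pose mC : 'M[R[i]]_n := \matrix_(i, j) C j i.
pose mD : 'M[R[i]]_n := \matrix_(i, j) D j i.
have inj (A B : 'M[R[i]]_n) :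
    (forall j, \sum_i A i j *: e i = \sum_i B i j *: e i) -> A = B.
  move=> h; apply/matrixP => i j; apply/eqP; rewrite -subr_eq0; apply/eqP.
  apply: (is_basis_free be (c := fun i => A i j - B i j)).
  under eq_bigr do rewrite scalerBl.
  by rewrite sumrB h subrr.
have comb (A B : 'M[R[i]]_n) j :
    \sum_i (A *m B) i j *: e i = \sum_k B k j *: \sum_i A i k *: e i.
  under eq_bigr do rewrite mxE scaler_suml.
  rewrite exchange_big; apply: eq_bigr => k _; rewrite scaler_sumr.
  by apply: eq_bigr => i _; rewrite scalerA mulrC.
have eC' j : \sum_i mC i j *: e i = e' j by rewrite eC; apply: eq_bigr => i _; rewrite mxE.
have CD : mC *m mD = 1%:M.
  apply: inj => j; rewrite comb.
  under eq_bigr do rewrite eC' mxE.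
  rewrite -eD (bigD1 j)//= mxE eqxx scale1r big1 ?addr0// => i /negbTE ij.
  by rewrite mxE ij scale0r.
have MC : M *m mC = mC *m M'.
  apply: inj => j; rewrite !comb.
  under [RHS]eq_bigr do rewrite eC'.
  rewrite -eM' -[in RHS]eC' linf_sum//; apply: eq_bigr => k _.
  by rewrite linfZ// eM.
have DC : mD *m mC = 1%:M by exact: mulmx1C.
by rewrite -[M']mul1mx -DC -mulmxA -MC mulmxA mxtrace_mulC mulmxA CD mul1mx.
Qed.

Section Eigenbasis.
Variables (V : set H) (T : H -> H) (n : nat) (e : 'I_n -> H) (l : 'I_n -> R[i]).
Hypothesis lT : linear T.
Hypothesis be : is_basis V e.
Hypothesis Te : forall i, T (e i) = l i *: e i.

Lemma trace_eigenbasis : trace_on T V = \sum_i l i.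
Proof.
rewrite (trace_onE (M := diag_mx (\row_i l i)) lT be).
  by rewrite mxtrace_diag; apply: eq_bigr => i _; rewrite mxE.
move=> j; rewrite Te (bigD1 j)//= !mxE eqxx mulr1n big1 ?addr0// => i /negbTE ij.
by rewrite !mxE ij mulr0n scale0r.
Qed.

(** The [e i] with [l i = c] form a basis of [W]: in coordinates, [T x = c *: x] reads
    [(l i - c) * a i = 0] for each [i]. *)
Lemma dim_eigenspace (c : R[i]) (W : set H) :
  (forall x, W x <-> V x /\ T x = c *: x) -> dim W = #|[set i | l i == c]%SET|.
Proof.
move=> hW; set A := [set i | l i == c]%SET; apply: (@dim_basis _ _ (fun k => e (enum_val k))).
split.
  move=> a h k.
  pose a' i := \sum_(j < #|A|) a j * (enum_val j == i)%:R.
  have <- : a' (enum_val k) = a k.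
    rewrite /a' (bigD1 k)//= eqxx mulr1 big1 ?addr0// => j /negbTE jk.
    by rewrite (inj_eq enum_val_inj) jk mulr0.
  apply: (is_basis_free be); rewrite -[RHS]h.
  under eq_bigr do rewrite scaler_suml.
  rewrite exchange_big; apply: eq_bigr => j _.
  rewrite (bigD1 (enum_val j))//= eqxx mulr1 big1 ?addr0// => i /negbTE.
  by rewrite eq_sym => ->; rewrite mulr0 scale0r.
move=> x; split.
  move=> /hW[/be.2[a ->]]; rewrite linf_sum// => h.
  have a0 i : i \notin A -> a i = 0.
    rewrite inE => li; have : (l i - c) * a i = 0.
      apply: (is_basis_free be (c := fun i => (l i - c) * a i)).
      rewrite -[RHS](subrr (c *: \sum_i a i *: e i)) -{1}h scaler_sumr -sumrB.
      apply: eq_bigr => j _; rewrite linfZ// Te !scalerA -scalerBl.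
      by congr (_ *: _); ring.
    by move/eqP; rewrite mulf_eq0 subr_eq0 (negbTE li) => /eqP.
  exists (fun k => a (enum_val k)).
  transitivity (\sum_(i in A) a i *: e i); last by rewrite big_enum_val.
  rewrite (bigID (mem A))/= [X in _ + X]big1 ?addr0//.
  by move=> i /a0 ->; rewrite scale0r.
move=> [a ->]; apply/hW; split.
  by apply: (subspace_sum (is_basis_subspace be)) => k; apply: subspaceZ;
    [exact: is_basis_subspace be|exact: is_basis_mem be].
rewrite linf_sum// scaler_sumr; apply: eq_bigr => k _.
rewrite linfZ// Te !scalerA mulrC; congr (_ * _ *: _).
by have := enum_valP k; rewrite inE => /eqP.
Qed.

End Eigenbasis.

End Bases.

(** * Spectral bands and resolvents *)

Section PvmDim.
Variables (R : realType) (H : hilbertType R) (K : set H) (E : set R -> H -> H).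
Hypothesis pvm : projection_valued_measure K E.
Implicit Types (A B : set R).

Lemma pvm_rangeP A x : measurable A -> range (E A) x <-> E A x = x.
Proof. by move=> mA; apply: oproj_rangeP; exact: pvm_oproj pvm _ mA. Qed.

Lemma pvm_range_subspace A : measurable A -> subspace (range (E A)).
Proof. by move=> mA; apply: oproj_range_subspace; exact: pvm_oproj pvm _ mA. Qed.

Lemma pvm_finite_dim_sub A B : measurable A -> measurable B -> A `<=` B ->
  finite_dim (range (E B)) -> finite_dim (range (E A)).
Proof.
move=> mA mB AB fB; apply: finite_dim_sub fB _ _; first exact: pvm_range_subspace.
by move=> x /(pvm_rangeP _ mA) h; apply/(pvm_rangeP _ mB); exact: pvm_sub pvm _ _ _ mA mB AB h.
Qed.

Lemma pvm_dimU A B : measurable A -> measurable B -> A `&` B = set0 ->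
  finite_dim (range (E A)) -> finite_dim (range (E B)) ->
  finite_dim (range (E (A `|` B))) /\
  dim (range (E (A `|` B))) = (dim (range (E A)) + dim (range (E B)))%N.
Proof.
move=> mA mB AB fA fB; have mU : measurable (A `|` B) by exact: measurableU.
apply: dim_add => //.
- move=> x; split.
    move=> /(pvm_rangeP _ mU) <-; exists (E A x), (E B x).
    by split; [exists x|exists x|rewrite (pvmU pvm)].
  move=> [v [w [/(pvm_rangeP _ mA) Av /(pvm_rangeP _ mB) Bw ->]]].
  apply/(pvm_rangeP _ mU); rewrite (linfD (pvm_linear pvm mU)).
  by rewrite (pvm_sub pvm mA mU _ Av) ?(pvm_sub pvm mB mU _ Bw).
- move=> v /(pvm_rangeP _ mA) Av /(pvm_rangeP _ mB) Bv.
  by rewrite -Av -Bv -(pvmI pvm)// AB (pvm_set0 pvm).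
Qed.

End PvmDim.

(** [band 1 a b] is []a, b]] and [band (-1) a b] is [[-b, -a[], the two halves of what the window
    [[-b, b]] adds to [[-a, a]]; the sign [s] lets one argument serve both. *)
Definition band (R : realType) (s a b : R) : set R := [set w | a < s * w <= b].

Lemma measurable_band (R : realType) (s a b : R) : measurable (band s a b).
Proof.
have -> : band s a b = (fun w => s * w) @^-1` `]a, b]%classic.
  by apply/seteqP; split => w; rewrite /band /preimage /= in_itv.
rewrite -[X in measurable X]setTI.
have mf : measurable_fun setT (fun w : R => s * w) by exact: measurable_funM.
by apply: mf => //; exact: measurable_itv.
Qed.

Lemma measurable_ray (R : realType) (s a : R) : measurable [set w : R | a <= s * w].
Proof.
have -> : [set w : R | a <= s * w] = (fun w => s * w) @^-1` `[a, +oo[%classic.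
  by apply/seteqP; split => w; rewrite /preimage /= in_itv /= andbT.
rewrite -[X in measurable X]setTI.
have mf : measurable_fun setT (fun w : R => s * w) by exact: measurable_funM.
by apply: mf => //; exact: measurable_itv.
Qed.

Section Resolvent.
Variables (R : realType) (H : hilbertType R) (K : set H) (E : set R -> H -> H)
  (S : operator H) (Rz : H -> H).
Hypothesis sm : sa_spectral_measure K S E.
Hypothesis linS : linear_operator S.
Hypothesis symS : symmetric_operator S.
Hypothesis resS : forall x, K x -> dom S (Rz x) /\ S (Rz x) + (Complex 0 1) *: Rz x = x.

Let pvm : projection_valued_measure K E. Proof. by case: sm. Qed.

Lemma rdot_i_sym x : dom S x -> rdot (S x) ((Complex 0 1) *: x) = 0.
Proof.
move=> Sx; rewrite rdotC rdotiZl.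
have := dotpC x (S x); rewrite symS//; case: (dotp x (S x)) => a b [] /= h.
by rewrite (_ : b = 0) ?oppr0//; lra.
Qed.

Lemma rn_iZ (x : H) : rn ((Complex 0 1) *: x) = rn x.
Proof. by rewrite rnZ normc_def /= expr0n expr1n add0r sqrtr1 mul1r. Qed.

(** Symmetry makes [<S x, x>] real, so the cross term with [i x] drops out. This yields both the
    injectivity of [S + i] and the contractivity of its inverse. *)
Lemma rn_shift_i x : dom S x ->
  rn (S x + (Complex 0 1) *: x) ^+ 2 = rn (S x) ^+ 2 + rn x ^+ 2.
Proof. by move=> Sx; rewrite rnD_sq rdot_i_sym// mulr0 addr0 rn_iZ. Qed.

Lemma resolvent_le x : K x -> rn (Rz x) <= rn x.
Proof.
move=> /resS[Sz e]; rewrite -ler_sqr ?nnegrE ?rn_ge0//.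
by rewrite -{2}e rn_shift_i// lerDr sqr_ge0.
Qed.

(** [Rz] is only assumed to be a right inverse of [S + i] on [K]; injectivity of [S + i] gives its
    additivity and its commutation with the spectral projections. *)
Lemma resolvent_unique x y : K x -> dom S y -> S y + (Complex 0 1) *: y = x -> y = Rz x.
Proof.
move=> Kx Sy e; have [Sz ez] := resS Kx.
have Sd : dom S (-1 *: Rz x + y) by exact: domP.
have := rn_shift_i Sd; rewrite (fctP linS)// scalerDr addrACA e.
rewrite scalerA mulrC -scalerA -scalerDr ez scaleN1r addNr rn0 expr0n /= => /esym/eqP.
rewrite paddr_eq0 ?sqr_ge0// => /andP[_ /eqP/rn_sq_eq0 /eqP].
by rewrite scaleN1r addrC subr_eq0 => /eqP.
Qed.

Lemma resolventB x y : K x -> K y -> Rz (x - y) = Rz x - Rz y.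
Proof.
move=> Kx Ky; have sK := pvm_subspace pvm.
have [Sx ex] := resS Kx; have [Sy ey] := resS Ky.
apply/esym; apply: resolvent_unique; first exact: subspaceB.
  by rewrite addrC -scaleN1r; exact: domP.
have -> : Rz x - Rz y = -1 *: Rz y + Rz x by rewrite scaleN1r addrC.
rewrite (fctP linS)// scalerDr addrACA.
by rewrite scalerA mulrC -scalerA -scalerDr ex ey scaleN1r addrC.
Qed.

Lemma resolvent_range A x : measurable A -> E A x = x -> E A (Rz x) = Rz x.
Proof.
move=> mA EA; have Kx := pvm_mem pvm mA EA; have [Sz ez] := resS Kx.
have lE := pvm_linear pvm mA.
apply: resolvent_unique => //; first exact: (sa_domE sm).
by rewrite (sa_commute sm linS)// -linfZ// -linfD// ez.
Qed.

(** With [z = Rz x] one has [x = S z + i z] and [Re <z, i z> = 0]. The sign of [S] is thus read off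
    a bounded form. *)
Lemma rdot_resolvent x : K x -> rdot (Rz x) x = rdot (S (Rz x)) (Rz x).
Proof.
move=> Kx; have [Sz ez] := resS Kx; rewrite -{2}ez rdotDr rdotC.
by rewrite [X in _ + X]rdotC rdotiZl dotpxx /= oppr0 addr0.
Qed.

(** For [z = Rz x] the form is at least [a |z|^2], while [|x| = |S z + i z| <= (b + 1) |z|]; this is
    the origin of the constant. *)
Lemma resolvent_form_ge (s a b : R) A x : s ^+ 2 = 1 -> 0 <= a -> 0 <= b ->
  measurable A -> (forall w, A w -> a <= s * w <= b) -> E A x = x ->
  a / (b + 1) ^+ 2 * rn x ^+ 2 <= s * rdot (Rz x) x.
Proof.
move=> s2 a0 b0 mA hA EA; have Kx := pvm_mem pvm mA EA; have [Sz ez] := resS Kx.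
have EAz := resolvent_range mA EA; rewrite rdot_resolvent//.
set z := Rz x in Sz ez EAz *.
have h1 : a * rn z ^+ 2 <= s * rdot (S z) z.
  have := rdot_shift_ge sm (s := s) (m := 0) (sigma := a) s2 mA _ Sz EAz.
  rewrite rdot_shift mul0r subr0; apply=> w /hA /andP[]; by rewrite subr0.
have h2 : rn (S z) <= b * rn z.
  have := rn_shift_le sm linS symS (s := s) (m := 0) (rho := b) s2 b0 mA _ EAz.
  rewrite /shift scale0r subr0 rnZ.
  have -> : complex.Re `|s%:C| = 1.
    rewrite normc_def /= expr0n addr0 s2 sqrtr1 //.
  rewrite mul1r; apply=> w /hA /andP[h h']; rewrite subr0 h' andbT.
  exact: le_trans h.
have h3 : rn x <= (b + 1) * rn z.
  by rewrite -ez (le_trans (rnD _ _))// rn_iZ mulrDl mul1r lerD2r.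
apply: le_trans h1; rewrite -mulrA ler_wpM2l// ler_pdivrMl ?exprn_gt0 ?ltr_wpDl//.
by rewrite -exprMn lerXn2r ?nnegrE ?rn_ge0// mulr_ge0 ?rn_ge0// addr_ge0.
Qed.

(** Finite rank yields a basis of eigenvectors of [S], with real eigenvalues by symmetry, all inside
    the band. Finitely many numbers [s * r i > a] stay away from 0 even when [a = 0]. *)
Lemma band_gap (s a b : R) : s ^+ 2 = 1 -> 0 <= a ->
  finite_dim (range (E (band s a b))) ->
  exists2 a', 0 < a' & forall x, E (band s a b) x = x ->
    E (band s a b `&` [set w | a' <= s * w]) x = x.
Proof.
move=> s2 a0; set B := band s a b => fB.
have mB : measurable B by exact: measurable_band.
have domV y : E B y = y -> dom S y.
  apply: (sa_shift_dom sm (m := 0) (rho := b) s2 mB) => w /andP[h1 h2].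
  by rewrite subr0 h2 andbT (le_trans a0)// ltW.
have lE := pvm_linear pvm mB.
have [n [e [l [be Se]]]] : exists n (e : 'I_n -> H) (l : 'I_n -> R[i]),
    is_basis (range (E B)) e /\ forall i, S (e i) = l i *: e i.
  apply: eigenbasis => //.
  - move=> x /(pvm_rangeP pvm _ mB) Vx; apply/(pvm_rangeP pvm _ mB).
    by rewrite -(sa_commute sm linS mB (domV _ Vx)) Vx.
  - move=> c x y /(pvm_rangeP pvm _ mB)/domV Sx /(pvm_rangeP pvm _ mB)/domV Sy.
    exact: fctP.
  - move=> k x y /(pvm_rangeP pvm _ mB)/domV Sx /(pvm_rangeP pvm _ mB)/domV Sy _ ex yx.
    by rewrite symS// ex dotpZr yx mulr0.
have Ve i : E B (e i) = e i by apply/(pvm_rangeP pvm _ mB); exact: is_basis_mem be.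
have e0 i : e i != 0.
  apply/eqP => ei; have := is_basis_free be (c := fun j => (j == i)%:R).
  rewrite big1; last by move=> j _; case: (eqVneq j i) => [->|_]; rewrite ?ei ?scaler0 ?scale0r.
  by move=> /(_ erefl i)/eqP; rewrite eqxx oner_eq0.
pose r i := complex.Re (l i).
have Er i : E [set r i] (e i) = e i.
  apply: (eigenvector_sa sm linS (domV _ (Ve i))); rewrite Se; congr (_ *: _).
  have := symS (domV _ (Ve i)) (domV _ (Ve i)); rewrite Se dotpZl dotpZr.
  have ee : dotp (e i) (e i) != 0 by apply: contra_neq (e0 i); exact: dotpxx_eq0.
  by move/(mulIf ee); rewrite /r; case: (l i) => p q [] /= h; rewrite (_ : q = 0)//; lra.
have m1 i : measurable [set r i] by exact: measurable_set1.
have Br i : B (r i).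
  apply: contrapT => nB; move: (e0 i) => /eqP; apply.
  rewrite -(Ve i) -(Er i) -(pvmI pvm)// (_ : B `&` [set r i] = set0) ?(pvm_set0 pvm)//.
  by apply/seteqP; split => // w [Bw wr]; apply: nB; rewrite -wr.
(* The initial value [1] keeps the minimum positive when the basis is empty. *)
exists (\big[Num.min/1]_i (s * r i)).
  apply: lt_bigmin => // i _; have /andP[h _] := Br i.
  exact: le_lt_trans h.
set B' := B `&` _.
have mB' : measurable B'.
  apply: measurableI => //.
  exact: measurable_ray.
have B'e i : E B' (e i) = e i.
  apply: (pvm_sub pvm (m1 i) mB' _ (Er i)) => w ->; split; first exact: Br.
  exact: bigmin_le_cond.
move=> x /(pvm_rangeP pvm _ mB)/(be.2 _)[c ->].
rewrite linf_sum; last exact: pvm_linear pvm _ mB'.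
by apply: eq_bigr => i _; rewrite linfZ ?B'e//; exact: pvm_linear pvm _ mB'.
Qed.

End Resolvent.

(** Connectedness of the segment: local constancy at [sup X] extends the set [X] past its supremum
    by [d / 2], unless the supremum is already [v]. *)
Lemma locally_constant_segment (R : realType) (N : R -> nat) (u v : R) : u <= v ->
  (forall s, u <= s <= v -> exists2 delta, 0 < delta &
     forall t, u <= t <= v -> `|t - s| < delta -> N t = N s) ->
  N u = N v.
Proof.
move=> uv h; pose X := [set t | u <= t <= v /\ forall s, u <= s <= t -> N s = N u].
have Xu : X u.
  split; first by rewrite lexx uv.
  by move=> s; rewrite -eq_le => /eqP ->.
have Xsup : has_sup X by split; [exists u|exists v => t [/andP[]]].
have um : u <= sup X by exact: ub_le_sup Xsup.2 _ Xu.
have mv : sup X <= v by apply: ge_sup => [|t [/andP[]]//]; exists u.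
have muv : u <= sup X <= v by rewrite um mv.
have [d d0 hd] := h _ muv.
have [t [/andP[ut tv] ht] mt] := sup_adherent d0 Xsup.
have tm : t <= sup X.
  by apply: ub_le_sup; [exact: Xsup.2|split => //; rewrite ut tv].
have Nm s : u <= s <= v -> s < sup X + d -> N s = N u.
  move=> /andP[us sv] sm; have [st|ts] := leP s t; first by apply: ht; rewrite us st.
  rewrite (hd s) ?us ?sv//; last by rewrite ltr_distl; apply/andP; split => //; exact: lt_trans ts.
  rewrite -(hd t) ?ut ?tv//; first by apply: ht; rewrite ut lexx.
  by rewrite ltr_distl mt /= (le_lt_trans tm)// ltrDl.
have [e|ne] := eqVneq (sup X) v.
  by apply/esym; apply: Nm; rewrite ?uv ?lexx// e ltrDl.
have mv' : sup X < v by rewrite lt_neqAle ne mv.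
pose m' := Num.min v (sup X + d / 2).
have d2 : 0 < d / 2 by rewrite divr_gt0.
have : m' <= sup X.
  apply: ub_le_sup; first exact: Xsup.2.
  split; first by rewrite /m' ge_min lexx /= le_min uv (le_trans um)// lerDl ltW.
  move=> s /andP[us]; rewrite le_min => /andP[sv sm]; apply: Nm; rewrite ?us ?sv//.
  by rewrite (le_lt_trans sm)// ltrD2l ltr_pdivrMr// ltr_pMr// ltr1n.
by rewrite ge_min leNgt mv' /= leNgt ltrDl d2.
Qed.

(** * Independence of the spectral flow of the flow partition *)

Section FlowIndependence.
Variables (R : realType) (H : hilbertType R) (K : set H)
  (F : R -> set R -> H -> H) (S : R -> operator H) (Res : R -> H -> H).
Hypothesis sm : forall t, `[0, 1]%classic t -> sa_spectral_measure K (S t) (F t).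
Hypothesis linS : forall t, `[0, 1]%classic t -> linear_operator (S t).
Hypothesis symS : forall t, `[0, 1]%classic t -> symmetric_operator (S t).
Hypothesis resS : forall t, `[0, 1]%classic t -> forall x, K x ->
  dom (S t) (Res t x) /\ S t (Res t x) + (Complex 0 1) *: Res t x = x.
Hypothesis cRes : norm_continuous_on `[0, 1]%classic Res.

Let pvm t : `[0, 1]%classic t -> projection_valued_measure K (F t).
Proof. by move=> /sm[]. Qed.

Lemma norm_continuous_rn (D : set R) (G : R -> H -> H) : norm_continuous_on D G ->
  forall t0, D t0 -> forall eps : R, 0 < eps -> exists2 delta : R, 0 < delta &
    forall t, D t -> `|t - t0| < delta -> forall x, rn (G t x - G t0 x) <= eps * rn x.
Proof.
move=> h t0 D0 eps e0; have [d d0 hd] := h t0 D0 eps e0; exists d => // t Dt td x.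
by have := hd t Dt td x; rewrite !normE -rmorphM lecR.
Qed.

Let window (a : R) : set R := `[- a, a]%classic.

Let good (u v a : R) := [/\ 0 <= a,
  forall t, `[u, v]%classic t -> finite_dim (range (F t (window a)))
  & norm_continuous_on `[u, v]%classic (fun t => F t (window a))].

Section TwoLevels.
Variables (u v a b : R).
Hypothesis uv01 : `[u, v]%classic `<=` `[0, 1]%classic.
Hypothesis uv : u <= v.
Hypothesis ab : a <= b.
Hypothesis ga : good u v a.
Hypothesis gb : good u v b.

Let a0 : 0 <= a. Proof. by case: ga. Qed.
Let b0 : 0 <= b. Proof. by case: gb. Qed.

(** The projection on [Q] is the difference of two window projections, hence norm continuous; this
    need not be clear for either half alone. *)
Let Q : set R := band 1 a b `|` band (-1) a b.

Let mband s : measurable (band s a b). Proof. exact: measurable_band. Qed.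
Let mQ : measurable Q. Proof. exact: measurableU. Qed.
Let mw c : measurable (window c). Proof. exact: measurable_itv. Qed.

Let windowE : window b = window a `|` Q.
Proof.
apply/seteqP; split => w; rewrite /window /Q /band /= !in_itv /= !mul1r !mulN1r.
  move=> /andP[h1 h2].
  have [wa|wa] : w < - a \/ - a <= w by case: (ltP w (- a)); [left|right].
    by right; right; apply/andP; split; lra.
  have [aw|aw] : w <= a \/ a < w by case: (leP w a); [left|right].
    by left; apply/andP; split.
  by right; left; apply/andP; split.
have := a0; have := ab.
by move=> ? ? [/andP[? ?]|[/andP[? ?]|/andP[? ?]]]; apply/andP; split; lra.
Qed.

Let disjQ : window a `&` Q = set0.
Proof.
apply/seteqP; split => // w; rewrite /window /Q /band /= !in_itv /= !mul1r !mulN1r.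
by move=> [/andP[? ?] [/andP[? ?]|/andP[? ?]]]; lra.
Qed.

Let disjB : band 1 a b `&` band (-1) a b = set0.
Proof.
apply/seteqP; split => // w; rewrite /band /= !mul1r !mulN1r.
by have := a0; move=> ? [/andP[? ?] /andP[? ?]]; lra.
Qed.

Let Qband s : s ^+ 2 = 1 -> Q = band s a b `|` band (- s) a b.
Proof.
move=> s2; have /orP[/eqP->//|/eqP->] : (s == 1) || (s == -1) by rewrite -sqrf_eq1 s2.
by rewrite opprK setUC.
Qed.

Let disjs s : s ^+ 2 = 1 -> band s a b `&` band (- s) a b = set0.
Proof.
move=> s2; have /orP[/eqP->//|/eqP->] : (s == 1) || (s == -1) by rewrite -sqrf_eq1 s2.
by rewrite opprK setIC.
Qed.

Let fQ t : `[u, v]%classic t -> finite_dim (range (F t Q)).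
Proof.
move=> tuv; have [_ fb _] := gb.
apply: (pvm_finite_dim_sub (pvm (uv01 tuv)) mQ (mw b) _ (fb _ tuv)).
by rewrite windowE; right.
Qed.

Let fband s t : s ^+ 2 = 1 -> `[u, v]%classic t -> finite_dim (range (F t (band s a b))).
Proof.
move=> s2 tuv.
apply: (pvm_finite_dim_sub (pvm (uv01 tuv)) (mband s) mQ _ (fQ tuv)).
by rewrite (Qband s2); left.
Qed.

Let cQ : norm_continuous_on `[u, v]%classic (fun t => F t Q).
Proof.
move=> t0 D0 eps e0; have [_ _ ca] := ga; have [_ _ cb] := gb.
have e2 : 0 < eps / 2 by rewrite divr_gt0.
have [d1 d10 h1] := norm_continuous_rn ca D0 e2.
have [d2 d20 h2] := norm_continuous_rn cb D0 e2.
exists (Num.min d1 d2); first by rewrite lt_min d10 d20.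
move=> t Dt; rewrite lt_min => /andP[t1 t2] x.
have FQ s : `[u, v]%classic s -> F s Q x = F s (window b) x - F s (window a) x.
  by move=> /uv01/pvm ps; rewrite windowE (pvmU ps x (mw a) mQ disjQ) (addrC (F s (window a) x)) addrK.
rewrite !normE -rmorphM lecR !FQ//.
have -> : F t (window b) x - F t (window a) x - (F t0 (window b) x - F t0 (window a) x) =
  (F t (window b) x - F t0 (window b) x) + (F t0 (window a) x - F t (window a) x).
  by rewrite opprB addrACA [RHS]addrACA; congr (_ + _); rewrite addrC.
rewrite (le_trans (rnD _ _))// [X in _ + X]rnB.
have := h1 _ Dt t1 x; have := h2 _ Dt t2 x; lra.
Qed.

(* If [F t (band s a b)] kills [x] in the range of [F t0 (band s a b)], then [y = F t Q x]
   is close to [x] and lies in the range of the opposite band, where the form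
   [s * rdot (Res t y) y] is nonpositive; but at [t0] the form is positive at [x]. *)
Lemma band_dim_lower s t0 : s ^+ 2 = 1 -> `[u, v]%classic t0 ->
  exists2 delta, 0 < delta & forall t, `[u, v]%classic t -> `|t - t0| < delta ->
    (dim (range (F t0 (band s a b))) <= dim (range (F t (band s a b))))%N.
Proof.
move=> s2 D0; have T0 := uv01 D0; have p0 := pvm T0.
have [a' a'0 gap] := band_gap (sm T0) (linS T0) (symS T0) s2 a0 (fband s2 D0).
set c := a' / (b + 1) ^+ 2.
have c0 : 0 < c by rewrite divr_gt0// exprn_gt0// ltr_wpDl.
(* Passing from the form at [t0] and [x] to the form at [t] and [y] changes the resolvent and then
   each of the two vectors. Each change costs at most [c / 8 * rn x ^+ 2], and the total
   [3 * (c / 8)] stays below [c]. *)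
have eps0 : 0 < c / 8 by rewrite divr_gt0.
have [d1 d10 h1] := norm_continuous_rn cQ D0 eps0.
have [d2 d20 h2] := norm_continuous_rn cRes T0 eps0.
exists (Num.min d1 d2); first by rewrite lt_min d10 d20.
move=> t Dt; rewrite lt_min => /andP[t1 t2].
have Tt := uv01 Dt; have pt := pvm Tt.
apply: (dim_inj (phi := F t (band s a b))).
- exact: fband.
- exact: fband.
- exact: pvm_linear pt _ (mband s).
- by move=> x _; exists x.
move=> x /(pvm_rangeP p0 _ (mband s)) Vx x0.
have Kx := pvm_mem p0 (mband s) Vx.
set y := F t Q x.
have Ky : K y by exact: pvmK pt _ _ mQ.
have yN : F t (band (- s) a b) y = y.
  have e : F t Q x = F t (band (- s) a b) x.
    by rewrite (Qband s2) (pvmU pt) ?x0 ?add0r//; exact: disjs.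
  by rewrite /y e (pvm_idem pt).
have Qx : F t0 Q x = x.
  by apply: (pvm_sub p0 (mband s) mQ _ Vx); rewrite (Qband s2); left.
have yx : rn (y - x) <= c / 8 * rn x by have := h1 _ Dt t1 x; rewrite Qx.
have yle : rn y <= rn x by exact: oproj_le (pvm_oproj pt mQ) _.
have neg : s * rdot (Res t y) y <= 0.
  have := resolvent_form_ge (sm Tt) (linS Tt) (symS Tt) (resS Tt) (s := - s) (a := 0)
    (b := b) _ (lexx _) b0 (mband (- s)) _ yN.
  rewrite sqrrN mul0r mul0r => /(_ s2); rewrite mulNr oppr_ge0; apply.
  by move=> w /andP[h ->]; rewrite andbT (le_trans a0)// ltW.
have pos : c * rn x ^+ 2 <= s * rdot (Res t0 x) x.
  apply: (resolvent_form_ge (sm T0) (linS T0) (symS T0) (resS T0) s2 (ltW a'0) b0 _ _ (gap _ Vx)).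
    apply: measurableI => //.
    exact: measurable_ray.
  by move=> w [/andP[_ ->]] /= ->.
have s1 := sqr1_norm s2.
have close : s * rdot (Res t0 x) x - s * rdot (Res t y) y <= 3 * (c / 8) * rn x ^+ 2.
  rewrite -mulrBr (le_trans (ler_norm _))// normrM s1 mul1r.
  have -> : rdot (Res t0 x) x - rdot (Res t y) y =
     - (rdot (Res t x - Res t0 x) x + rdot (Res t y - Res t x) x + rdot (Res t y) (y - x)).
    rewrite !(rdotDl, rdotDr, rdotNl, rdotNr); ring.
  rewrite normrN (le_trans (ler_normD _ _))//.
  have sK := pvm_subspace pt.
  have b1 : `|rdot (Res t x - Res t0 x) x| <= c / 8 * rn x ^+ 2.
    rewrite (le_trans (rdot_abs_le _ _))// expr2 mulrA ler_wpM2r ?rn_ge0//.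
    exact: h2.
  have b2 : `|rdot (Res t y - Res t x) x| <= c / 8 * rn x ^+ 2.
    rewrite (le_trans (rdot_abs_le _ _))// expr2 mulrA ler_wpM2r ?rn_ge0//.
    rewrite -(resolventB (sm Tt) (linS Tt) (symS Tt) (resS Tt))//.
    rewrite (le_trans (resolvent_le (symS Tt) (resS Tt) _))//.
    exact: subspaceB.
  have b3 : `|rdot (Res t y) (y - x)| <= c / 8 * rn x ^+ 2.
    rewrite (le_trans (rdot_abs_le _ _))//.
    have -> : c / 8 * rn x ^+ 2 = rn x * (c / 8 * rn x) by ring.
    apply: ler_pM; rewrite ?rn_ge0//.
    by rewrite (le_trans (resolvent_le (symS Tt) (resS Tt) Ky)).
  rewrite (le_trans (lerD (ler_normD _ _) (lexx _)))//.
  move: b1 b2 b3; lra.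
apply: rn_sq_eq0; apply/eqP; rewrite eq_le sqr_ge0 andbT.
rewrite -(ler_pM2l c0) mulr0; move: pos neg close; lra.
Qed.

(** Projections at distance at most [1 / 2] have injective restrictions to each other's range: a
    fixed vector [x] of one that the other kills satisfies [|x| <= |x| / 2]. *)
Let Q_dim_upper t0 : `[u, v]%classic t0 ->
  exists2 delta, 0 < delta & forall t, `[u, v]%classic t -> `|t - t0| < delta ->
    (dim (range (F t Q)) <= dim (range (F t0 Q)))%N.
Proof.
move=> D0; have p0 := pvm (uv01 D0).
have half0 : (0 : R) < 1 / 2 by rewrite divr_gt0.
have [d d0 hd] := norm_continuous_rn cQ D0 half0.
exists d => // t Dt td; have pt := pvm (uv01 Dt).
apply: (dim_inj (phi := F t0 Q)).
- exact: fQ.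
- exact: fQ.
- exact: pvm_linear p0 _ mQ.
- by move=> x _; exists x.
move=> x /(pvm_rangeP pt _ mQ) Vx x0; apply: rn_eq0.
have := hd _ Dt td x; rewrite Vx x0 subr0; have := rn_ge0 x; lra.
Qed.

Let dimQ t : `[u, v]%classic t ->
  dim (range (F t Q)) = (dim (range (F t (band 1 a b))) + dim (range (F t (band (-1) a b))))%N.
Proof.
move=> Dt; apply: (pvm_dimU (pvm (uv01 Dt)) (mband 1) (mband (-1)) disjB _ _).2.
  by apply: fband; rewrite ?expr1n.
by apply: fband; rewrite ?sqrrN ?expr1n.
Qed.

Let band_dim_constant :
  dim (range (F u (band 1 a b))) = dim (range (F v (band 1 a b))).
Proof.
apply: (@locally_constant_segment _ (fun t => dim (range (F t (band 1 a b)))) u v uv).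
move=> t0 h0; have D0 : `[u, v]%classic t0 by rewrite /= in_itv.
have [d1 d10 h1] := @band_dim_lower 1 t0 (expr1n _ _) D0.
have s2 : (-1 : R) ^+ 2 = 1 by rewrite sqrrN expr1n.
have [d2 d20 h2] := @band_dim_lower (-1) t0 s2 D0.
have [d3 d30 h3] := Q_dim_upper D0.
exists (Num.min d1 (Num.min d2 d3)); first by rewrite !lt_min d10 d20.
move=> t ht; rewrite !lt_min => /and3P[t1 t2 t3].
have Dt : `[u, v]%classic t by rewrite /= in_itv.
have {}h1 := h1 _ Dt t1; have {}h2 := h2 _ Dt t2; have := h3 _ Dt t3.
rewrite !dimQ// => {}h3; apply/eqP; rewrite eqn_leq h1 andbT.
by rewrite -(leq_add2r (dim (range (F t (band (-1) a b))))) (leq_trans h3)// leq_add2l.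
Qed.

Let dim0b t : `[u, v]%classic t ->
  dim (range (F t `[0, b]%classic)) =
  (dim (range (F t `[0%R, a]%classic)) + dim (range (F t (band 1 a b))))%N.
Proof.
move=> Dt; have pt := pvm (uv01 Dt).
have -> : `[0, b]%classic = `[0, a]%classic `|` band 1 a b.
  apply/seteqP; split => w; rewrite /band /= !in_itv /= mul1r.
    move=> /andP[h1 h2]; have [aw|aw] : w <= a \/ a < w by case: (leP w a); [left|right].
      by left; apply/andP; split.
    by right; apply/andP; split.
  by have := a0; have := ab; move=> ? ? [/andP[? ?]|/andP[? ?]]; apply/andP; split; lra.
apply: (pvm_dimU pt _ (mband 1) _ _ _).2; first exact: measurable_itv.
- apply/seteqP; split => // w; rewrite /band /= !in_itv /= mul1r.
  by move=> [/andP[? ?] /andP[? ?]]; lra.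
- have [_ fa _] := ga; apply: (pvm_finite_dim_sub pt _ (mw a) _ (fa _ Dt)).
    exact: measurable_itv.
  move=> w; rewrite /window /= !in_itv /= => /andP[? ->]; rewrite andbT.
  by have := a0; lra.
- by apply: fband; rewrite ?expr1n.
Qed.

Lemma two_levels_le :
  (dim (range (F v `[0, b]%classic)))%:Z - (dim (range (F u `[0, b]%classic)))%:Z =
  (dim (range (F v `[0, a]%classic)))%:Z - (dim (range (F u `[0, a]%classic)))%:Z.
Proof.
rewrite !dim0b ?band_dim_constant /= ?in_itv /= ?lexx ?uv//.
by rewrite !PoszD opprD addrACA subrr addr0.
Qed.

End TwoLevels.

Let jump (a u v : R) : int :=
  (dim (range (F v `[0, a]%classic)))%:Z - (dim (range (F u `[0, a]%classic)))%:Z.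

Lemma two_levels (u v a b : R) : `[u, v]%classic `<=` `[0, 1]%classic -> u <= v ->
  good u v a -> good u v b -> jump a u v = jump b u v.
Proof.
move=> uv01 uv ga gb; case: (leP a b) => [ab|/ltW ba].
  exact/esym/two_levels_le.
exact: two_levels_le.
Qed.

Let good_sub (u v u' v' a : R) : `[u', v']%classic `<=` `[u, v]%classic ->
  good u v a -> good u' v' a.
Proof.
move=> h [a0 fa ca]; split => //; first by move=> t /h; exact: fa.
move=> s /h Ds eps e0; have [d d0 hd] := ca s Ds eps e0.
by exists d => // t /h; exact: hd.
Qed.

(** Clipping the times of one partition into each interval of another replaces the construction of a
    common refinement; disjoint intervals collapse to a point, where the jump vanishes. *)
Definition clip (lo hi x : R) : R := Num.min hi (Num.max lo x).

Lemma clip_id (lo hi : R) : lo <= hi ->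
  (forall x, x <= lo -> clip lo hi x = lo) /\ (forall x, hi <= x -> clip lo hi x = hi).
Proof.
move=> h; split => x hx; rewrite /clip.
  by rewrite (max_idPl hx) (min_idPr h).
by rewrite (max_idPr (le_trans h hx)) (min_idPl hx).
Qed.

(* Both sides are the jump over the intersection of [[t, t']] and [[s, s']], or vanish. *)
Lemma jump_clip (t t' s s' a b : R) : t <= t' -> s <= s' ->
  `[t, t']%classic `<=` `[0, 1]%classic -> good t t' a -> good s s' b ->
  jump a (clip t t' s) (clip t t' s') = jump b (clip s s' t) (clip s s' t').
Proof.
move=> tt ss h01 ga gb.
have [c1 c2] := clip_id tt; have [c3 c4] := clip_id ss.
have [ts|st] := leP t' s.
  rewrite (c2 s)// (c2 s') ?(le_trans ts)// (c3 t) ?(c3 t') ?(le_trans tt)//.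
  by rewrite /jump !subrr.
have [st'|ts'] := leP s' t.
  rewrite (c1 s') ?(c1 s) ?(le_trans ss)// (c4 t)// (c4 t') ?(le_trans st')//.
  by rewrite /jump !subrr.
have e1 : clip t t' s = Num.max t s.
  by rewrite /clip; apply/min_idPr; rewrite ge_max tt ltW.
have e2 : clip t t' s' = Num.min t' s' by rewrite /clip (max_idPr (ltW ts')).
have e3 : clip s s' t = Num.max t s.
  by rewrite /clip maxC; apply/min_idPr; rewrite ge_max ss ltW.
have e4 : clip s s' t' = Num.min t' s' by rewrite /clip (max_idPr (ltW st)) minC.
rewrite e1 e2 e3 e4.
have h1 : `[Num.max t s, Num.min t' s']%classic `<=` `[t, t']%classic.
  by move=> w; rewrite /= !in_itv /= ge_max le_min => /andP[/andP[-> _] /andP[-> _]].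
have h2 : `[Num.max t s, Num.min t' s']%classic `<=` `[s, s']%classic.
  by move=> w; rewrite /= !in_itv /= ge_max le_min => /andP[/andP[_ ->] /andP[_ ->]].
apply: two_levels; first exact: subset_trans h1 h01.
- by rewrite ge_max !le_min tt ss (ltW ts') (ltW st).
- exact: good_sub h1 ga.
- exact: good_sub h2 gb.
Qed.

Lemma partition_times p : flow_partition F p -> forall i j, (i <= j <= size_part p)%N ->
  time p i <= time p j.
Proof.
move=> [_ _ inc _] i; elim=> [|j IHj]; first by rewrite leqn0 => /andP[/eqP->].
move=> /andP[]; rewrite leq_eqVlt => /orP[/eqP->//|ij jn].
rewrite (le_trans (IHj _))//; first by rewrite -ltnS ij ltnW.
by apply/ltW; have := inc j.+1; rewrite /= jn; apply.
Qed.

Lemma partition_times01 p : flow_partition F p -> forall i, (i <= size_part p)%N ->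
  `[0, 1]%classic (time p i).
Proof.
move=> fp i ip; have [<- <- _ _] := fp.
by rewrite /= in_itv /= !(partition_times fp) ?ip ?leqnn.
Qed.

Lemma partition_sub01 p k : flow_partition F p -> (1 <= k <= size_part p)%N ->
  `[time p k.-1, time p k]%classic `<=` `[0, 1]%classic.
Proof.
move=> fp /andP[_ kn] w; have := partition_times01 fp kn.
have := partition_times01 fp (leq_trans (leq_pred k) kn).
rewrite /= !in_itv /= => /andP[h1 _] /andP[_ h2] /andP[h3 h4].
by rewrite (le_trans h1 h3) (le_trans h4 h2).
Qed.

Let jump_telescope a (f : nat -> R) m :
  jump a (f 0%N) (f m) = \sum_(1 <= j < m.+1) jump a (f j.-1) (f j).
Proof.
rewrite big_add1 /=.
exact/esym/(telescope_sumr (fun j => (dim (range (F (f j) `[0, a]%classic)))%:Z)).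
Qed.

(** Telescoping over the clipped times turns each flow into a double sum over pairs of intervals,
    one from each partition; [jump_clip] matches the two double sums term by term. *)
Theorem flow_independence p q : flow_partition F p -> flow_partition F q ->
  sf_partition F p = sf_partition F q.
Proof.
move=> fp fq.
have refine p1 p2 : flow_partition F p1 -> flow_partition F p2 ->
    sf_partition F p1 = \sum_(1 <= k < (size_part p1).+1) \sum_(1 <= j < (size_part p2).+1)
      jump (level p1 k) (clip (time p1 k.-1) (time p1 k) (time p2 j.-1))
                        (clip (time p1 k.-1) (time p1 k) (time p2 j)).
  move=> f1 f2; apply: eq_big_nat => k; rewrite ltnS => kn.
  have [t0 tn inc _] := f2.
  have kk : (k.-1 <= size_part p1)%N by case/andP: kn => _; apply: leq_trans; exact: leq_pred.
  have le : time p1 k.-1 <= time p1 k.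
    by apply: (partition_times f1); rewrite leq_pred; case/andP: kn.
  have [c1 c2] := clip_id le.
  have T1 := partition_times01 f1 kk.
  have T2 : `[0, 1]%classic (time p1 k) by apply: (partition_times01 f1); case/andP: kn.
  rewrite -(jump_telescope (level p1 k) (fun j => clip (time p1 k.-1) (time p1 k) (time p2 j))).
  (* The times 0 and 1 of [p2] clip to the two ends of the interval of [p1]. *)
  rewrite t0 tn c1 ?c2 //.
    by move: T2; rewrite /= in_itv /= => /andP[].
  by move: T1; rewrite /= in_itv /= => /andP[].
rewrite (refine p q)// (refine q p)// exchange_big.
apply: eq_big_nat => j; rewrite ltnS => jn; apply: eq_big_nat => k; rewrite ltnS => kn.
have [_ _ _ hp] := fp; have [_ _ _ hq] := fq.
have pk : (k.-1 <= k <= size_part p)%N by rewrite leq_pred; case/andP: kn.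
have qj : (j.-1 <= j <= size_part q)%N by rewrite leq_pred; case/andP: jn.
apply: jump_clip; [exact: partition_times fp _ _ pk|exact: partition_times fq _ _ qj| | |].
- exact: partition_sub01 kn.
- exact: hp.
- exact: hq.
Qed.

End FlowIndependence.

(** * Restriction to the eigenspaces of gamma *)

Section BorelC.
Variable R : realType.

Lemma measurable_borelC (p : R[i] -> R) :
  (forall z w, `|p z - p w|%:C <= `|z - w|) ->
  measurable_fun (setT : set (borelC R)) (fun w : borelC R => p w).
Proof.
move=> hp; apply: (@measurability _ _ _ _ _ _ (@RGenOInfty.G R)); first exact: RGenOInfty.measurableE.
move=> _ [_ [x ->] <-].
rewrite setTI; apply: sub_sigma_algebra; rewrite /= openE => z /=.
rewrite /preimage /= in_itv /= andbT => xz.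
apply/nbhs_ballP; exists (p z - x)%:C; first by rewrite /= ltcR subr_gt0.
move=> w; rewrite /ball /= => zw; rewrite in_itv /= andbT.
have := le_lt_trans (hp z w) zw; rewrite ltcR => h.
by have := ler_norm (p z - p w); lra.
Qed.

Lemma measurable_Re_borelC :
  measurable_fun (setT : set (borelC R)) (fun w : borelC R => complex.Re (w : R[i])).
Proof. by apply: (@measurable_borelC (@complex.Re R)) => z w; rewrite -raddfB normc_ge_Re. Qed.

Lemma measurable_Im_borelC :
  measurable_fun (setT : set (borelC R)) (fun w : borelC R => complex.Im (w : R[i])).
Proof.
apply: (@measurable_borelC (@complex.Im R)) => z w; rewrite -raddfB normc_def lecR.
by rewrite -sqrtr_sqr ler_sqrt ?addr_ge0 ?sqr_ge0// lerDr sqr_ge0.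
Qed.

Lemma measurable_set1_borelC (l : R[i]) : measurable ([set l] : set (borelC R)).
Proof.
have -> : [set l] = (fun w : borelC R => complex.Re (w : R[i])) @^-1` [set complex.Re l] `&`
    (fun w : borelC R => complex.Im (w : R[i])) @^-1` [set complex.Im l].
  apply/seteqP; split => w /=; first by move=> ->.
  by move=> [h1 h2]; apply/eqP; rewrite eq_complex h1 h2 !eqxx.
apply: measurableI.
  by have := measurable_Re_borelC measurableT (measurable_set1 (complex.Re l)); rewrite setTI.
by have := measurable_Im_borelC measurableT (measurable_set1 (complex.Im l)); rewrite setTI.
Qed.

End BorelC.

Section Projections.
Variables (R : realType) (H : hilbertType R) (P Q : H -> H).
Hypothesis oP : orthogonal_projection P.
Hypothesis oQ : orthogonal_projection Q.

(** Invariance of the range of [P] means [P Q P = Q P]; the left side is symmetric, so passing to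
    adjoints gives [P Q P = P Q]. *)
Lemma oproj_comm : (forall x, P x = x -> P (Q x) = Q x) -> forall x, P (Q x) = Q (P x).
Proof.
move=> h x; have PQP y : P (Q (P y)) = Q (P y) by apply: h; rewrite oproj_idem.
rewrite -PQP; apply/eqP; rewrite -subr_eq0; apply/eqP/dotpxx_eq0.
set z := _ - _; rewrite {1}/z dotpDl dotpNl.
rewrite (oproj_sym oP) (oproj_sym oQ) -PQP.
rewrite [X in _ - X](oproj_sym oP) (oproj_sym oQ) (oproj_sym oP).
by rewrite subrr.
Qed.

End Projections.

Lemma self_adjoint_symmetric (R : realType) (H : hilbertType R) (S : operator H) :
  self_adjoint S -> symmetric_operator S.
Proof. by move=> [_ _ h] x y Sx Sy; have /(_ x Sx) := (h y (S y)).2 (conj Sy erefl). Qed.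

Lemma eq_cintegral d (T : measurableType d) (R : realType) (m1 m2 : set T -> \bar R)
    (f : T -> R[i]) :
  (forall A, measurable A -> m1 A = m2 A) -> cintegral m1 f = cintegral m2 f.
Proof. by move=> h; rewrite /cintegral !(eq_integral_raw _ h). Qed.

Section EqFamily.
Variables (R : realType) (H : hilbertType R) (E1 E2 : R -> set R -> H -> H).
Hypothesis E12 : forall t, `[0, 1]%classic t -> forall A, measurable A -> E1 t A = E2 t A.

Lemma flow_partition_eq p : flow_partition E1 p ->
  flow_partition E2 p /\ sf_partition E1 p = sf_partition E2 p.
Proof.
move=> fp; have T01 := partition_times01 fp; have [t0 t1 inc h] := fp.
have sub01 k := @partition_sub01 _ _ _ p k fp.
split.
  split => // k hk; have [a0 fa ca] := h k hk; split => //.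
    move=> s hs; rewrite -E12; [exact: fa|exact: sub01 hk _ hs|exact: measurable_itv].
  move=> s hs eps e0; have [d d0 hd] := ca s hs eps e0; exists d => // t ht td x.
  by rewrite -!E12; [exact: hd|..]; try exact: measurable_itv; exact: sub01 hk _ _.
apply: eq_big_nat => k; rewrite ltnS => /andP[_ kn].
by rewrite !E12//; apply: T01 => //; exact: leq_trans (leq_pred k) kn.
Qed.

End EqFamily.

(** * Spectral flow of the restrictions and decomposition of traces *)

Section Main.
Variables (R : realType) (H : hilbertType R) (gamma : H -> H) (A : R -> operator H).
Hypothesis gamma_unitary : unitary gamma.
Hypothesis A_self_adjoint : forall t : R, `[0, 1]%classic t -> self_adjoint (A t).
Hypothesis A_gap_continuous : gap_continuous A.
Hypothesis A_commutes : forall t : R, `[0, 1]%classic t -> commutes_with gamma (A t).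
Variable G : set (borelC R) -> H -> H.
Hypothesis G_spectral : spectral_measure setT (everywhere gamma) G.
Variable E : R -> set R -> H -> H.
Hypothesis E_spectral : forall t : R, `[0, 1]%classic t -> sa_spectral_measure setT (A t) (E t).

Let lin_gamma : linear gamma. Proof. by case: gamma_unitary. Qed.
Let dot_gamma x y : dotp (gamma x) (gamma y) = dotp x y.
Proof. by case: gamma_unitary. Qed.

Let rn_gamma x : rn (gamma x) <= 1 * rn x.
Proof.
rewrite mul1r -ler_sqr ?nnegrE ?rn_ge0//.
by rewrite -!rdotxx /rdot dot_gamma.
Qed.

Let linA t : `[0, 1]%classic t -> linear_operator (A t).
Proof. by move=> /A_self_adjoint[]. Qed.

Let symA t : `[0, 1]%classic t -> symmetric_operator (A t).
Proof. by move=> /A_self_adjoint/self_adjoint_symmetric. Qed.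

Let lin_egamma : linear_operator (everywhere gamma).
Proof. by split => // c x y _ _; split => //; exact: lin_gamma. Qed.

Let pvmG : projection_valued_measure setT G. Proof. by case: G_spectral. Qed.
Let spiG : is_spectral_integral (fun z : borelC R => z : R[i]) setT G (everywhere gamma).
Proof. by case: G_spectral. Qed.
Let pvmE t : `[0, 1]%classic t -> projection_valued_measure setT (E t).
Proof. by move=> /E_spectral[]. Qed.

Let oG (l : R[i]) : orthogonal_projection (G [set l]).
Proof. exact: pvm_oproj pvmG _ (measurable_set1_borelC l). Qed.

(** Replaces membership in a spectral subspace by an algebraic condition, which passes through
    [A t], its resolvent and [E t] by commutation with [gamma]. *)
Lemma range_eigenspace (l : R[i]) x : range (G [set l]) x <-> gamma x = l *: x.
Proof.
rewrite (oproj_rangeP (oG l)); split.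
  move=> h; have := @spi_eigenvector _ (borelC R) R H _ setT G (everywhere gamma)
    (@measurable_Re_borelC R) (@measurable_Im_borelC R) pvmG lin_egamma spiG [set l] l x
    (measurable_set1_borelC l).
  by move=> /(_ _ h)[]// w ->.
move=> h; have [_] := @eigenvector_spi _ (borelC R) R H _ setT G (everywhere gamma)
    (@measurable_Re_borelC R) (@measurable_Im_borelC R) pvmG lin_egamma spiG l x Logic.I h.
by have -> : [set w : borelC R | (w : R[i]) = l] = [set l] by apply/seteqP; split => w.
Qed.

Lemma gamma_commutes t I x : `[0, 1]%classic t -> measurable I ->
  gamma (E t I x) = E t I (gamma x).
Proof.
move=> T mI; apply: (intertwining (E_spectral T) (linA T) (symA T) (E_spectral T)
  (linA T) lin_gamma rn_gamma) => // y Sy.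
exact: A_commutes.
Qed.

Let F (l : R[i]) (t : R) (I : set R) (x : H) : H := G [set l] (E t I x).

Let GE l t I x : `[0, 1]%classic t -> measurable I ->
  G [set l] (E t I x) = E t I (G [set l] x).
Proof.
move=> T mI; apply: (oproj_comm (oG l) (pvm_oproj (pvmE T) mI)).
move=> y /(oproj_rangeP (oG l))/range_eigenspace h.
apply/(oproj_rangeP (oG l))/range_eigenspace.
by rewrite gamma_commutes// h linfZ//; exact: pvm_linear (pvmE T) _ mI.
Qed.

(** [F l t I] is a product of two orthogonal projections that commute by [GE], hence again an
    orthogonal projection. *)
Let pvmF l t : `[0, 1]%classic t -> projection_valued_measure (range (G [set l])) (F l t).
Proof.
move=> T; have p := pvmE T; split.
- move=> I mI; have oE := pvm_oproj p mI; split.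
  + move=> c x y; rewrite /F (pvm_linear p mI).
    by case: (oG l) => lG _ _; rewrite lG.
  + by move=> x; rewrite /F -GE// (oproj_idem (oG l)) (pvm_idem p).
  + move=> x y; rewrite /F (oproj_sym (oG l)) (oproj_sym oE).
    by rewrite GE.
- apply/seteqP; split => x [y _ <-].
    by exists (E t setT y).
  exists y => //; rewrite /F; congr (G _ _); exact/(pvmT p).
- move=> I J mI mJ x; rewrite /F (pvmI p)// -(GE l (E t J x))//.
  by rewrite (oproj_idem (oG l)).
- move=> B mB tB x.
  have lG : linear (G [set l]) by case: (oG l).
  have -> : (fun n => \sum_(k < n) F l t (B k) x) =
      G [set l] \o (fun n => \sum_(k < n) E t (B k) x).
    by apply/funext => n /=; rewrite linf_sum.
  exact: cvgH_linear lG (oproj_le1 (oG l)) (pvm_sigma p (x := x) mB tB).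
Qed.

Let K_subspace l : subspace (range (G [set l])).
Proof. exact: oproj_range_subspace. Qed.

(** On vectors of the eigenspace the scalar measures of [F l t] and [E t] coincide, so the domain
    condition and the form are inherited; commutation with [gamma] keeps [A t] inside the
    eigenspace. *)
Let smF l t : `[0, 1]%classic t ->
  sa_spectral_measure (range (G [set l])) (restr (A t) (range (G [set l]))) (F l t).
Proof.
move=> T; split; first exact: pvmF.
have [_ [h1 h2]] := E_spectral T.
have same x : range (G [set l]) x -> forall I, measurable I ->
    scalar_measure (F l t) x I = scalar_measure (E t) x I.
  move=> /(oproj_rangeP (oG l)) Kx I mI; rewrite /scalar_measure /F.
  by rewrite (oproj_sym (oG l)) Kx.
split.
  move=> x; split.
    move=> [/h1[_ hx] Kx]; split => //.
    by rewrite (eq_integral_raw _ (same x Kx)).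
  move=> [Kx hx]; split => //; apply/h1; split => //.
  by rewrite -(eq_integral_raw _ (same x Kx)).
move=> x [Sx Kx]; split.
  apply/range_eigenspace; have [_ <-] := A_commutes T Sx.
  move/range_eigenspace: Kx => ->.
  exact: (fctZ (linA T)).
by rewrite (eq_cintegral _ (same x Kx)); have [] := h2 x Sx.
Qed.

Let linR l t : `[0, 1]%classic t -> linear_operator (restr (A t) (range (G [set l]))).
Proof.
move=> T; have lA := linA T; have sK := K_subspace l; split.
  by split; [exact: (dom0 lA)|exact: sK.1].
move=> c x y [Sx Kx] [Sy Ky]; split; last exact: (fctP lA).
by split; [exact: (domP lA)|exact: sK.2].
Qed.

Let symR l t : `[0, 1]%classic t -> symmetric_operator (restr (A t) (range (G [set l]))).
Proof. by move=> T x y [Sx _] [Sy _]; exact: symA. Qed.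

(** Composing with [G [set l]] shrinks the ranges, since it commutes with [E t I], and does not
    increase norms. *)
Let flowF l p : flow_partition E p -> flow_partition (F l) p.
Proof.
move=> fp; have [t0 t1 inc h] := fp.
have sub01 k := @partition_sub01 _ _ _ p k fp.
split => // k hk; have [a0 fa ca] := h k hk; split => //.
  move=> s hs; have Ts := sub01 k hk _ hs.
  have mI : measurable `[- level p k, level p k]%classic by exact: measurable_itv.
  apply: (finite_dim_sub (fa s hs)); first exact: (pvm_range_subspace (pvmF l Ts)).
  by move=> _ [y _ <-]; rewrite /F GE//; exists (G [set l] y).
move=> s hs eps e0; have [d d0 hd] := ca s hs eps e0; exists d => // t ht td x.
have lG : linear (G [set l]) by case: (oG l).
rewrite /F -linfB//; apply: le_trans (hd t ht td x).
by rewrite !normE lecR; exact: oproj_le.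
Qed.

(** The pair chosen by [xget] is arbitrary: its measure is identified with [F l] by intertwining
    with the identity, and its partition is then exchanged for [p] by [flow_independence]. *)
Lemma sf_eigenspace l p : flow_partition E p ->
  sf (range (G [set l])) (fun t => restr (A t) (range (G [set l]))) = sf_partition (F l) p.
Proof.
move=> fp; rewrite /sf; case: xgetP => [s _|/(_ (sf_partition (F l) p))[]]; last first.
  by exists (F l), p; split => //; [exact: smF|exact: flowF].
move=> [E' [p' [smE' fp' ->]]].
have E'F t : `[0, 1]%classic t -> forall I, measurable I -> E' t I = F l t I.
  move=> T I mI; apply/funext => x.
  have pE' : projection_valued_measure (range (G [set l])) (E' t) by case: (smE' t T).
  have pF := pvmF l T.
  have onK y : range (G [set l]) y -> E' t I y = F l t I y.
    have lid : linear (id : H -> H) by [].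
    have bid z : rn (id z : H) <= 1 * rn z by rewrite mul1r.
    have UK z : range (G [set l]) z -> range (G [set l]) (id z) by [].
    have US z : dom (restr (A t) (range (G [set l]))) z ->
      dom (restr (A t) (range (G [set l]))) (id z) /\
      restr (A t) (range (G [set l])) (id z) = id (restr (A t) (range (G [set l])) z) by [].
    have h := intertwining (smE' t T) (linR l T) (@symR l t T) (smF l T) (linR l T) lid bid UK US mI.
    exact: h.
  (* Off the eigenspace both measures first project onto it, so agreement on the eigenspace
     suffices. *)
  have eT : E' t setT x = F l t setT x.
    apply: oproj_range_inj; [exact: pvm_oproj pE' _ measurableT|exact: pvm_oproj pF _ measurableT|].
    by move=> y; rewrite -(pvmT pE') (pvmT pF).
  rewrite -[I]setIT (pvmI pE')// (pvmI pF)// -eT; apply: onK.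
  exact: pvmK pE' _ _ measurableT.
have [fF ->] := flow_partition_eq E'F fp'.
have [Res [hRes cRes]] := A_gap_continuous.
apply: (flow_independence (@smF l) (@linR l) (@symR l) _ cRes) => //; last exact: flowF.
move=> t T x Kx; have [r1 r2] := hRes t T; have [Sz ez] := r1 x.
have lA := linA T.
split; last by rewrite complexiE.
split => //; apply/range_eigenspace.
(* The resolvent of [A t] inherits the commutation with [gamma], so it maps the eigenspace to itself
   and serves as resolvent of the restriction. *)
have [Sgz egz] := A_commutes T Sz.
rewrite -(r2 _ Sgz) egz -linfZ// -linfD// ez.
move/range_eigenspace: Kx => ->.
rewrite -{1}ez scalerDr scalerA mulrC -scalerA -(fctZ lA)// r2//.
by apply: (subspaceZ (dom_subspace lA)).
Qed.

Let Fdim l t I := dim (range (F l t I)).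

(** The formula is given over every duplicate-free list containing [s], so that traces at different
    times and levels can be added over one common list. *)
Lemma trace_decomposition t I : `[0, 1]%classic t -> measurable I ->
  finite_dim (range (E t I)) ->
  exists s : seq R[i], [/\ forall l, l \in s -> Eig (everywhere gamma) l,
    forall l, l \notin s -> Fdim l t I = 0%N &
    forall s', uniq s' -> {subset s <= s'} ->
      trace_on gamma (range (E t I)) = \sum_(l <- s') l * (Fdim l t I)%:R].
Proof.
move=> T mI fV; have p := pvmE T.
have [n [e [l [be ge]]]] : exists n (e : 'I_n -> H) (l : 'I_n -> R[i]),
    is_basis (range (E t I)) e /\ forall i, gamma (e i) = l i *: e i.
  apply: eigenbasis => //.
  - move=> x /(pvm_rangeP p _ mI) Vx; apply/(pvm_rangeP p _ mI).
    by rewrite -gamma_commutes// Vx.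
  - by move=> c x y _ _; exact: lin_gamma.
  - move=> k x y _ _ x0 gx yx.
    (* An eigenvalue of a unitary operator is nonzero, so it can be cancelled in
       [<gamma y, gamma x> = <y, x>]; this gives the invariance of orthogonal complements. *)
    have k0 : k != 0.
      apply: contra_neq x0 => k0; apply: dotpxx_eq0.
      by rewrite -dot_gamma gx k0 scale0r dotp0l.
    have := dot_gamma y x; rewrite gx dotpZr yx => /eqP.
    by rewrite mulf_eq0 conjc_eq0 (negbTE k0) => /eqP.
have dimE c : Fdim c t I = #|[set i | l i == c]%SET|.
  apply: (dim_eigenspace lin_gamma be ge) => x.
  rewrite (pvm_rangeP (pvmF c T) _ mI) (pvm_rangeP p _ mI) -range_eigenspace.
  rewrite (oproj_rangeP (oG c)) /F; split.
    move=> h; split.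
      by rewrite -h GE// (pvm_idem p).
    by rewrite -h (oproj_idem (oG c)).
  by move=> [-> ->].
exists [seq l i | i <- enum 'I_n]; split.
- move=> _ /mapP[i _ ->]; exists (e i); split => //.
  apply/eqP => ei; have := is_basis_free be (c := fun j => (j == i)%:R).
  rewrite big1; last by move=> j _; case: (eqVneq j i) => [->|_]; rewrite ?ei ?scaler0 ?scale0r.
  by move=> /(_ erefl i)/eqP; rewrite eqxx oner_eq0.
- move=> c hc; rewrite dimE; apply: eq_card0 => i; rewrite !inE.
  by apply: contraNF hc => /eqP <-; apply: map_f; rewrite mem_enum.
- move=> s' us' ss'; rewrite (trace_eigenbasis lin_gamma be ge).
  (* Indicators of [l i = c] allow the sum over basis vectors to be regrouped by eigenvalue. *)
  transitivity (\sum_i \sum_(c <- s') (l i == c)%:R * c).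
    apply: eq_bigr => i _.
    have li : l i \in s' by apply: ss'; apply: map_f; rewrite mem_enum.
    rewrite (bigD1_seq (l i))//= eqxx mul1r big1 ?addr0// => c.
    by rewrite eq_sym => /negbTE ->; rewrite mul0r.
  rewrite exchange_big; apply: eq_bigr => c _ /=.
  rewrite -mulr_suml mulrC dimE -sum1_card natr_sum [in RHS]big_mkcond /=.
  by congr (_ * _); apply: eq_bigr => i _; rewrite inE; case: eqP.
Qed.

(** Gathering the eigenvalues met at both ends of all intervals gives one finite list; vanishing off
    this list makes the sum over [Eig] finite. *)
Lemma sf_gamma_decomposition p : flow_partition E p ->
  exists s : seq R[i], [/\ uniq s, forall l, l \in s -> Eig (everywhere gamma) l,
    forall l, l \notin s -> sf_partition (F l) p = 0 &
    sf_gamma_partition gamma E p = \sum_(l <- s) l * (sf_partition (F l) p)%:~R].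
Proof.
move=> fp; have T01 := partition_times01 fp; have [t0 t1 inc h] := fp.
have fV k t : (1 <= k <= size_part p)%N -> `[time p k.-1, time p k]%classic t ->
    `[0, 1]%classic t -> finite_dim (range (E t `[0, level p k]%classic)).
  move=> hk ht T; have [a0 fa _] := h k hk.
  apply: (pvm_finite_dim_sub (pvmE T) _ _ _ (fa t ht)); [exact: measurable_itv..|].
  by move=> w; rewrite /= !in_itv /= => /andP[w0 ->]; rewrite andbT; lra.
have dec k : exists s : seq R[i], (1 <= k <= size_part p)%N ->
    [/\ forall l, l \in s -> Eig (everywhere gamma) l,
    forall l, l \notin s -> Fdim l (time p k) `[0, level p k]%classic = 0%N /\
      Fdim l (time p k.-1) `[0, level p k]%classic = 0%N &
    forall s', uniq s' -> {subset s <= s'} ->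
      trace_on gamma (range (E (time p k) `[0, level p k]%classic)) -
      trace_on gamma (range (E (time p k.-1) `[0, level p k]%classic)) =
      \sum_(l <- s') l * ((Fdim l (time p k) `[0, level p k]%classic)%:Z -
        (Fdim l (time p k.-1) `[0, level p k]%classic)%:Z)%:~R].
  (* Indices outside the partition get the empty list, so that [choice] applies to all [k]. *)
  have [hk|hk] := boolP (1 <= k <= size_part p)%N; last by exists [::].
  have le : time p k.-1 <= time p k by apply: (partition_times fp); rewrite leq_pred; case/andP: hk.
  have Tk : `[0, 1]%classic (time p k) by apply: T01; case/andP: hk.
  have Tk' : `[0, 1]%classic (time p k.-1).
    by apply: T01; apply: leq_trans (leq_pred k) _; case/andP: hk.
  have mI : measurable `[0, level p k]%classic by exact: measurable_itv.
  have i1 : `[time p k.-1, time p k]%classic (time p k) by rewrite /= in_itv /= le lexx.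
  have i2 : `[time p k.-1, time p k]%classic (time p k.-1) by rewrite /= in_itv /= le lexx.
  have [s1 [e1 z1 d1]] := trace_decomposition Tk mI (fV _ _ hk i1 Tk).
  have [s2 [e2 z2 d2]] := trace_decomposition Tk' mI (fV _ _ hk i2 Tk').
  exists (s1 ++ s2) => _; split.
  - by move=> l; rewrite mem_cat => /orP[/e1|/e2].
  - by move=> l; rewrite mem_cat negb_or => /andP[/z1 -> /z2 ->].
  - move=> s' us' ss'.
    rewrite (d1 s')//; last by move=> l l1; apply: ss'; rewrite mem_cat l1.
    rewrite (d2 s')//; last by move=> l l2; apply: ss'; rewrite mem_cat l2 orbT.
    rewrite -sumrB; apply: eq_bigr => l _.
    by rewrite -mulrBr rmorphB.
have [s hs] := choice dec.
pose S := undup (flatten [seq s k | k <- iota 1 (size_part p)]).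
have sS k : (1 <= k <= size_part p)%N -> {subset s k <= S}.
  move=> hk l ls; rewrite mem_undup; apply/flattenP; exists (s k) => //.
  by apply: map_f; rewrite mem_iota add1n ltnS.
exists S; split.
- exact: undup_uniq.
- move=> l; rewrite mem_undup => /flattenP[_ /mapP[k + ->]].
  by rewrite mem_iota add1n ltnS => hk; have [he _ _] := hs k hk; exact: he.
- move=> l lS; rewrite /sf_partition big_nat big1// => k; rewrite ltnS => hk.
  have [_ hz _] := hs k hk.
  have [|z1 z2] := hz l; first by apply: contra lS; exact: sS.
  by rewrite -/(Fdim l _ _) z1 -/(Fdim l _ _) z2 subrr.
- rewrite /sf_gamma_partition /sf_partition.
  under [RHS]eq_bigr do rewrite rmorph_sum mulr_sumr.
  rewrite exchange_big; apply: eq_big_nat => k; rewrite ltnS => hk.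
  have [_ _ hd] := hs k hk.
  by rewrite (hd S)//; [exact: undup_uniq|exact: sS].
Qed.

End Main.

Theorem theorem3p10 (R : realType) (H : hilbertType R)
    (gamma : H -> H) (A : R -> operator H)
    (gamma_unitary : unitary gamma)
    (A_self_adjoint : forall t : R, `[0, 1]%classic t -> self_adjoint (A t))
    (A_fredholm : forall t : R, `[0, 1]%classic t -> fredholm (A t))
    (A_gap_continuous : gap_continuous A)
    (A_commutes : forall t : R, `[0, 1]%classic t -> commutes_with gamma (A t))
    (* the spectral measures I |-> P_I(gamma) and I |-> P_I(A(t)) *)
    (G : set (borelC R) -> H -> H)
    (G_spectral : spectral_measure setT (everywhere gamma) G)
    (E : R -> set R -> H -> H)
    (E_spectral : forall t : R, `[0, 1]%classic t ->
       sa_spectral_measure setT (A t) (E t)) :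
  let E_ (lambda : R[i]) : set H := range (G [set lambda]) in
  let sf_ (lambda : R[i]) : int :=
    sf (E_ lambda) (fun t => restr (A t) (E_ lambda)) in
  (forall p, flow_partition E p ->
     finite_set [set lambda | Eig (everywhere gamma) lambda /\
                              sf_ lambda != 0] /\
     sf_gamma_partition gamma E p =
       \sum_(lambda \in Eig (everywhere gamma)) lambda * (sf_ lambda)%:~R) /\
  (forall p q, flow_partition E p -> flow_partition E q ->
     sf_gamma_partition gamma E p = sf_gamma_partition gamma E q).
Proof.
move=> E_ sf_.
have key p : flow_partition E p ->
    finite_set [set lambda | Eig (everywhere gamma) lambda /\ sf_ lambda != 0] /\
    sf_gamma_partition gamma E p =
      \sum_(lambda \in Eig (everywhere gamma)) lambda * (sf_ lambda)%:~R.
  move=> fp.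
  have sfE l : sf_ l = sf_partition (fun t I x => G [set l] (E t I x)) p.
    exact: (sf_eigenspace gamma_unitary A_self_adjoint A_gap_continuous A_commutes
      G_spectral E_spectral l fp).
  have [s [us sEig s0 ->]] := sf_gamma_decomposition gamma_unitary A_self_adjoint
    A_commutes G_spectral E_spectral fp.
  split.
    apply: sub_finite_set (finite_seq s) => l [_ hl] /=.
    by apply: contraNT hl => /s0 h; rewrite sfE h.
  under eq_bigr do rewrite -sfE.
  (* Enlarging the index set from [s] to all eigenvalues only adds zero terms. *)
  rewrite fsbig_seq//; apply: fsbig_widen; first by move=> l; exact: sEig.
  by move=> l [_ /= /negP/s0 h]; rewrite sfE h mulr0.
split=> // p q /key[_ ->] /key[_ ->]//.
Qed.
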